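(* Let $Q$ be a source injective representation quiver and let $R$ be a Gorenstein ring. A representation $\mathcal{M}\in(Q,R\text{-Mod})$ is Gorenstein injective if and only if for each vertex $v$ of $Q$, $\mathcal{M}(v)$ is a Gorenstein injective left $R$-module and the sequence $$0\to \ker(f_v)\to\mathcal{M}(v)\xrightarrow{f_v}\prod_{s(a)=v}\mathcal{M}(t(a))\to 0$$ is exact with $\ker(f_v)$ a Gorenstein injective left $R$-module, where $f_v:\mathcal{M}(v)\to\prod_{s(a)=v}\mathcal{M}(t(a))$ is the map induced by the maps $\mathcal{M}(a):\mathcal{M}(v)\to\mathcal{M}(t(a))$.
   Context: Rings are associative with identity, not necessarily commutative. A quiver $Q$ consists of a set $V$ of vertices, a set $\Gamma$ of arrows and source and target maps $s,t:\Gamma\to V$; both sets may be infinite, and loops and multiple arrows are allowed. $(Q,R\text{-Mod})$ is the category of representations of $Q$ by left $R$-modules: a representation $\mathcal{X}$ assigns a left $R$-module $\mathcal{X}(v)$ to each vertex $v$ and a homomorphism $\mathcal{X}(a):\mathcal{X}(s(a))\to\mathcal{X}(t(a))$ to each arrow $a$; morphisms are natural transformations. A quiver $Q$ is a source injective representation quiver if for every ring $R$ and every $\mathcal{X}\in(Q,R\text{-Mod})$: $\mathcal{X}$ is injective if and only if (i) $\mathcal{X}(v)$ is an injective $R$-module for every vertex $v$ and (ii) for every vertex $v$ the morphism $\mathcal{X}(v)\to\prod_{s(a)=v}\mathcal{X}(t(a))$ induced by the maps $\mathcal{X}(a)$ is a splitting epimorphism. A Gorenstein ring (in the sense of Iwanaga)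 is a left and right noetherian ring having finite injective dimension both as a left and as a right module over itself. An object $M$ of an abelian category is Gorenstein injective if there is an exact sequence $\cdots\to E_{-2}\to E_{-1}\to E_0\to E_1\to E_2\to\cdots$ of injective objects with $M=\ker(E_0\to E_1)$ which remains exact after applying $\mathrm{Hom}(E,-)$ for every injective object $E$. *)

(* Defs.v *)
(* Rings are [pzRingType]s, so the zero ring is allowed; since every type has a
   classical choice structure, [pzRingType] and [lmodType R] cover all rings and
   all left modules. *)
From HB Require Import structures.
From mathcomp Require Import all_boot all_algebra.
From mathcomp Require Import boolp.

Set Implicit Arguments.
Unset Strict Implicit.
Unset Printing Implicit Defensive.
Import GRing.Theory.
Local Open Scope ring_scope.

(* The notions below make sense in any category with zero morphisms; only the
   zero morphisms (not the addition of morphisms) are needed to state them.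
   Morphisms are compared by Leibniz equality. *)
Record category := Category {
  obj :> Type;
  hom : obj -> obj -> Type;
  idm : forall A, hom A A;
  compose : forall A B D, hom B D -> hom A B -> hom A D;
  zerom : forall A B, hom A B;
  comp1m : forall A B (f : hom A B), compose (idm B) f = f;
  compm1 : forall A B (f : hom A B), compose f (idm A) = f;
  compA : forall A B D E (f : hom A B) (g : hom B D) (h : hom D E),
    compose h (compose g f) = compose (compose h g) f;
  comp0m : forall A B D (f : hom A B), compose (zerom B D) f = zerom A D;
  compm0 : forall A B D (g : hom B D), compose g (zerom A B) = zerom A D }.

Arguments idm {c} A.
Arguments compose {c A B D}.
Arguments zerom {c} A B.

Section Categorical.
Variable C : category.
Implicit Types A B D X : C.

Definition mono A B (f : hom A B) : Prop :=
  forall X (u v : hom X A), compose f u = compose f v -> u = v.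

Definition epi A B (f : hom A B) : Prop :=
  forall X (u v : hom B X), compose u f = compose v f -> u = v.

Definition split_epi A B (f : hom A B) : Prop :=
  exists s : hom B A, compose f s = idm B.

Definition zero_object A : Prop := idm A = zerom A A.

Definition is_kernel A B (g : hom A B) K (k : hom K A) : Prop :=
  compose g k = zerom K B /\
  forall X (h : hom X A), compose g h = zerom X B ->
    exists! u : hom X K, compose k u = h.

(* A -f-> B -g-> D is exact at B when the image of f is the kernel of g, that
   is, when f is an epimorphism followed by a kernel of g. *)
Definition exact_at A B D (f : hom A B) (g : hom B D) : Prop :=
  exists (K : C) (k : hom K B) (e : hom A K),
    [/\ is_kernel g k, epi e & f = compose k e].

(* 0 -> A -> B -> D -> 0 *)
Definition short_exact A B D (f : hom A B) (g : hom B D) : Prop :=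
  [/\ mono f, exact_at f g & epi g].

Definition injective_object E : Prop :=
  forall A B (i : hom A B), mono i ->
    forall f : hom A E, exists g : hom B E, compose g i = f.

Definition finite_injective_dimension A : Prop :=
  exists (n : nat) (E : nat -> C) (d : forall k, hom (E k) (E k.+1))
         (eps : hom A (E 0)),
    [/\ forall k, injective_object (E k),
        forall k, (n < k)%N -> zero_object (E k),
        mono eps,
        exact_at eps (d 0)
      & forall k, exact_at (d k) (d k.+1)].

(* Exactness of Hom(E, A) -> Hom(E, B) -> Hom(E, D), as a sequence of abelian
   groups. *)
Definition hom_exact E A B D (f : hom A B) (g : hom B D) : Prop :=
  forall h : hom E B,
    compose g h = zerom E D <-> exists u : hom E A, compose f u = h.

(* For i ranging over all of int, [exact_at (d i) (d (i + 1))] is exactness at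
   E (i + 1), hence at every term. *)
Definition gorenstein_injective (M : C) : Prop :=
  exists (E : int -> C) (d : forall i : int, hom (E i) (E (i + 1)))
         (iota : hom M (E 0)),
    [/\ forall i, injective_object (E i),
        forall i, exact_at (d i) (d (i + 1)),
        is_kernel (d 0) iota
      & forall J : C, injective_object J ->
          forall i, hom_exact J (d i) (d (i + 1))].

End Categorical.

Lemma linear_ext (R : pzRingType) (U V : lmodType R) (f g : {linear U -> V}) :
  (forall x, f x = g x) -> f = g.
Proof.
move=> fg; have {}fg : (f : U -> V) = g by apply: funext.
case: f g fg => [f [[fz] [fs]]] [g [[gz] [gs]]] /= fg; subst g.
by rewrite (Prop_irrelevance fz gz) (Prop_irrelevance fs gs).
Qed.

Section ModuleCategory.
Variable R : pzRingType.
Implicit Types U V W : lmodType R.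

Definition lin_id U : {linear U -> U} := idfun.
Definition lin_comp U V W (g : {linear V -> W}) (f : {linear U -> V}) :
  {linear U -> W} := g \o f.
Definition lin_zero U V : {linear U -> V} := \0.

Fact lin_comp1m U V (f : {linear U -> V}) : lin_comp (lin_id V) f = f.
Proof. exact: linear_ext. Qed.
Fact lin_compm1 U V (f : {linear U -> V}) : lin_comp f (lin_id U) = f.
Proof. exact: linear_ext. Qed.
Fact lin_compA U V W (X : lmodType R) (f : {linear U -> V}) (g : {linear V -> W})
  (h : {linear W -> X}) : lin_comp h (lin_comp g f) = lin_comp (lin_comp h g) f.
Proof. exact: linear_ext. Qed.
Fact lin_comp0m U V W (f : {linear U -> V}) :
  lin_comp (lin_zero V W) f = lin_zero U W.
Proof. exact: linear_ext. Qed.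
Fact lin_compm0 U V W (g : {linear V -> W}) :
  lin_comp g (lin_zero U V) = lin_zero U W.
Proof. by apply: linear_ext => x /=; rewrite linear0. Qed.

Definition LMod : category :=
  @Category (lmodType R) (fun U V => {linear U -> V})
    lin_id lin_comp lin_zero lin_comp1m lin_compm1 lin_compA
    lin_comp0m lin_compm0.

End ModuleCategory.

Section Kernel.
Variables (R : pzRingType) (U V : lmodType R) (f : {linear U -> V}).

Definition ker_pred : {pred U} := [pred x | f x == 0].

Fact ker_submod_closed : submod_closed ker_pred.
Proof.
split=> [|a x y]; rewrite !inE ?linear0 // => /eqP fx /eqP fy.
by rewrite linearP fx fy scaler0 addr0.
Qed.

HB.instance Definition _ :=
  GRing.isSubmodClosed.Build R U ker_pred ker_submod_closed.

Record ker := Ker { ker_val : U; _ : ker_val \in ker_pred }.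
HB.instance Definition _ := [isSub for ker_val].
HB.instance Definition _ := [Choice of ker by <:].
HB.instance Definition _ := [SubChoice_isSubLmodule of ker by <:].

Definition ker_incl : {linear ker -> U} := val.

End Kernel.

Section Product.
Variables (R : pzRingType) (I : Type) (F : I -> lmodType R).

Definition prodM : Type := forall i, F i.

HB.instance Definition _ := gen_eqMixin prodM.
HB.instance Definition _ := gen_choiceMixin prodM.

Definition prodM_zero : prodM := fun=> 0.
Definition prodM_opp (x : prodM) : prodM := fun i => - x i.
Definition prodM_add (x y : prodM) : prodM := fun i => x i + y i.
Definition prodM_scale (a : R) (x : prodM) : prodM := fun i => a *: x i.

Fact prodM_addA : associative prodM_add.
Proof. by move=> x y z; apply: functional_extensionality_dep => i; apply: addrA. Qed.
Fact prodM_addC : commutative prodM_add.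
Proof. by move=> x y; apply: functional_extensionality_dep => i; apply: addrC. Qed.
Fact prodM_add0 : left_id prodM_zero prodM_add.
Proof. by move=> x; apply: functional_extensionality_dep => i; apply: add0r. Qed.
Fact prodM_addN : left_inverse prodM_zero prodM_opp prodM_add.
Proof. by move=> x; apply: functional_extensionality_dep => i; apply: addNr. Qed.

HB.instance Definition _ :=
  GRing.isZmodule.Build prodM prodM_addA prodM_addC prodM_add0 prodM_addN.

Fact prodM_scaleA a b x :
  prodM_scale a (prodM_scale b x) = prodM_scale (a * b) x.
Proof. by apply: functional_extensionality_dep => i; apply: scalerA. Qed.
Fact prodM_scale1 : left_id 1 prodM_scale.
Proof. by move=> x; apply: functional_extensionality_dep => i; apply: scale1r. Qed.
Fact prodM_scaleDr : right_distributive prodM_scale +%R.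
Proof. by move=> a x y; apply: functional_extensionality_dep => i; apply: scalerDr. Qed.
Fact prodM_scaleDl x : {morph prodM_scale^~ x : a b / a + b}.
Proof. by move=> a b; apply: functional_extensionality_dep => i; apply: scalerDl. Qed.

HB.instance Definition _ := GRing.Zmodule_isLmodule.Build R prodM
  prodM_scaleA prodM_scale1 prodM_scaleDr prodM_scaleDl.

Variables (U : lmodType R) (f : forall i, {linear U -> F i}).

Definition to_prodM_fun (x : U) : prodM := fun i => f i x.

Fact to_prodM_linear : linear to_prodM_fun.
Proof.
by move=> a x y; apply: functional_extensionality_dep => i; apply: linearP.
Qed.

HB.instance Definition _ :=
  GRing.isLinear.Build R U prodM _ to_prodM_fun to_prodM_linear.

Definition to_prodM : {linear U -> prodM} := to_prodM_fun.

End Product.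

Record quiver := Quiver {
  vertex : Type;
  arrow : Type;
  src : arrow -> vertex;
  tgt : arrow -> vertex }.

Section Representations.
Variables (Q : quiver) (R : pzRingType).

Record rep := Rep {
  rep_obj :> vertex Q -> lmodType R;
  rep_map : forall a : arrow Q, {linear rep_obj (src a) -> rep_obj (tgt a)} }.

Record rep_hom (X Y : rep) := RepHom {
  rep_hom_at :> forall v, {linear X v -> Y v};
  rep_hom_natural : forall (a : arrow Q) (x : X (src a)),
    rep_hom_at (tgt a) (rep_map X a x) = rep_map Y a (rep_hom_at (src a) x) }.

Lemma rep_hom_ext (X Y : rep) (f g : rep_hom X Y) :
  (forall v x, f v x = g v x) -> f = g.
Proof.
move=> fg; have {}fg : rep_hom_at f = rep_hom_at g.
  by apply: functional_extensionality_dep => v; apply: linear_ext => x; apply: fg.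
case: f g fg => [f fn] [g gn] /= fg; subst g.
by rewrite (Prop_irrelevance fn gn).
Qed.

Definition rep_id (X : rep) : rep_hom X X :=
  @RepHom X X (fun v => lin_id (X v)) (fun _ _ => erefl).

Fact rep_comp_natural (X Y Z : rep) (g : rep_hom Y Z) (f : rep_hom X Y)
  (a : arrow Q) (x : X (src a)) :
  lin_comp (g (tgt a)) (f (tgt a)) (rep_map X a x)
    = rep_map Z a (lin_comp (g (src a)) (f (src a)) x).
Proof. by rewrite /= !rep_hom_natural. Qed.

Definition rep_comp (X Y Z : rep) (g : rep_hom Y Z) (f : rep_hom X Y) :
  rep_hom X Z :=
  @RepHom X Z (fun v => lin_comp (g v) (f v)) (rep_comp_natural g f).

Fact rep_zero_natural (X Y : rep) (a : arrow Q) (x : X (src a)) :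
  lin_zero (X (tgt a)) (Y (tgt a)) (rep_map X a x)
    = rep_map Y a (lin_zero (X (src a)) (Y (src a)) x).
Proof. by rewrite /= linear0. Qed.

Definition rep_zero (X Y : rep) : rep_hom X Y :=
  @RepHom X Y (fun v => lin_zero (X v) (Y v)) (@rep_zero_natural X Y).

Fact rep_comp1m X Y (f : rep_hom X Y) : rep_comp (rep_id Y) f = f.
Proof. exact: rep_hom_ext. Qed.
Fact rep_compm1 X Y (f : rep_hom X Y) : rep_comp f (rep_id X) = f.
Proof. exact: rep_hom_ext. Qed.
Fact rep_compA X Y Z W (f : rep_hom X Y) (g : rep_hom Y Z) (h : rep_hom Z W) :
  rep_comp h (rep_comp g f) = rep_comp (rep_comp h g) f.
Proof. exact: rep_hom_ext. Qed.
Fact rep_comp0m X Y Z (f : rep_hom X Y) :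
  rep_comp (rep_zero Y Z) f = rep_zero X Z.
Proof. exact: rep_hom_ext. Qed.
Fact rep_compm0 X Y Z (g : rep_hom Y Z) :
  rep_comp g (rep_zero X Y) = rep_zero X Z.
Proof. by apply: rep_hom_ext => v x /=; rewrite linear0. Qed.

Definition RepCat : category :=
  @Category rep rep_hom rep_id rep_comp rep_zero
    rep_comp1m rep_compm1 rep_compA rep_comp0m rep_compm0.

Definition out_arrow (v : vertex Q) : Type := {a : arrow Q | src a = v}.

(* X(a) : X(v) -> X(t(a)), for an arrow a with s(a) = v; the match transports
   along the equation s(a) = v. *)
Definition rep_out_map (X : rep) (v : vertex Q) (a : out_arrow v) :
  {linear X v -> X (tgt (sval a))} :=
  match svalP a in _ = w return {linear X w -> X (tgt (sval a))} with
  | erefl => rep_map X (sval a)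
  end.

Definition out_prod (X : rep) (v : vertex Q) : lmodType R :=
  prodM (fun a : out_arrow v => X (tgt (sval a))).

Definition out_map (X : rep) (v : vertex Q) : {linear X v -> out_prod X v} :=
  to_prodM (@rep_out_map X v).

End Representations.

Definition source_injective_representation_quiver (Q : quiver) : Prop :=
  forall (R : pzRingType) (X : rep Q R),
    @injective_object (RepCat Q R) X <->
    (forall v, @injective_object (LMod R) (X v)) /\
    (forall v, @split_epi (LMod R) (X v) (out_prod X v) (out_map X v)).

(* Ascending chain condition on submodules. *)
Definition noetherian_module (R : pzRingType) (M : lmodType R) : Prop :=
  forall S : nat -> {pred M},
    (forall n, submod_closed (S n)) ->
    (forall n, {subset S n <= S n.+1}) ->
    exists N, forall n, (N <= n)%N -> S n =i S N.

(* [R^o] is R as a left module over itself; right R-modules are left modules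
   over the opposite ring [R^c], so [(R^c)^o] is R as a right module over
   itself. *)
Definition gorenstein_ring (R : pzRingType) : Prop :=
  [/\ noetherian_module (R^o : lmodType R),
      noetherian_module ((R^c)^o : lmodType R^c),
      @finite_injective_dimension (LMod R) (R^o : lmodType R)
    & @finite_injective_dimension (LMod R^c) ((R^c)^o : lmodType R^c)].

(* Main.v *)
Require Import Defs.
From HB Require Import structures.
From mathcomp Require Import all_boot all_algebra.
From mathcomp Require Import boolp classical_sets.
(* Below, hom denotes the morphisms of a category. *)
Import Defs.

(** Call a short exact sequence 0 -> A -> E -> B -> 0 proper when every morphism
    from an injective object to B lifts to E.  Cutting a complete resolution
    into short exact sequences, and splicing such sequences back together,
    shows that M is Gorenstein injective if and only if it belongs to a class of
    objects each of which starts and ends a proper short exact sequence with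
    injective middle term and third term in the class
    ([gorenstein_injective_coind], [gorenstein_injective_steps]).  Both
    implications are proved in this form, without derived functors: Ext appears
    only as the solvability of lifting problems.

    Let f_v : X(v) -> prod_(s(a) = v) X(t(a)) be the map of the statement.

    Sufficiency.  The class is that of the representations X for which every
    X(v) is Gorenstein injective and f_v lifts maps from injective modules; a
    representation as in the statement is of this kind because such maps lift
    along any epimorphism with Gorenstein injective kernel
    ([GI_kernel_lifts]).  To cover X by an injective representation, choose
    proper covers E_v -> X(v) by injective modules.  Each X(a) lifts to a map
    E_(s(a)) -> E_(t(a)), and since a quiver imposes no relation these lifts
    form a representation with injective modules; it is usually not
    injective, but becomes so after adding at v a product, over the walks of
    positive length that leave v, of injective modules attached to their ends:
    this is [walk_ext].  The enlarged representation still maps onto X, and the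
    kernel, which is again a [walk_ext], stays in the class.  Embedding X into
    an injective representation with cokernel in the class is dual.
    It remains to see that morphisms h from an injective representation J lift
    along these sequences.  Vertexwise lifts of h exist, and their failure to
    be natural is a family of maps J(s(a)) -> X(t(a)) into the kernel X
    ([ext_vanishes]).  Correcting it is possible when X is injective, and hence
    for every vertexwise proper quotient of an injective representation, in
    particular for every X in the class.

    Necessity.  Let E -> N be a proper epimorphism of representations, with E
    injective and N Gorenstein injective, and let g : I -> N(v) be a map from an
    injective module.  The direct sums of copies of I indexed by the maps
    I -> N(w) form a representation that maps to N and realizes g; its modules
    are injective because R is left noetherian ([injective_coproduct]).  It
    embeds into an injective representation with injective cokernel, the map to
    N extends, and properness lifts it to E; so g lifts to E(v)
    ([GI_rep_lifts_at]).  Hence evaluation at v, and then also ker(f_v),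
    transforms proper resolutions into proper resolutions. *)

Set Implicit Arguments.
Unset Strict Implicit.
Unset Printing Implicit Defensive.
Import GRing.Theory.
Local Open Scope ring_scope.

Lemma dchoice (I : Type) (T : I -> Type) (P : forall i, T i -> Prop) :
  (forall i, exists x, P i x) -> exists f : forall i, T i, forall i, P i (f i).
Proof.
by move=> ex; exists (fun i => sval (cid (ex i))) => i; apply: svalP (cid (ex i)).
Qed.

(** * Proper short exact sequences and Gorenstein injective objects *)

Section ProperExactness.
Variable C : category.
Implicit Types A B E J M N : C.

Definition inj_lifting E B (p : hom E B) : Prop :=
  forall J, injective_object J ->
    forall h : hom J B, exists u : hom J E, compose p u = h.

Definition proper_ses A E B (i : hom A E) (p : hom E B) : Prop :=
  [/\ is_kernel p i, epi p & inj_lifting p].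

Definition right_step (P : C -> Prop) A : Prop :=
  exists E B (i : hom A E) (p : hom E B),
    [/\ injective_object E, P B & proper_ses i p].

Definition left_step (P : C -> Prop) B : Prop :=
  exists A E (i : hom A E) (p : hom E B),
    [/\ injective_object E, P A & proper_ses i p].

Lemma kernel_mono A E B (p : hom E B) (i : hom A E) :
  is_kernel p i -> mono i.
Proof.
move=> [pi0 uniq] X u v uv.
have [|w [_ wu]] := uniq X (compose i u); first by rewrite compA pi0 comp0m.
by rewrite -(wu u erefl) -(wu v (esym uv)).
Qed.

Lemma kernel_comp_mono A E B D (p : hom E B) (i : hom A E) (j : hom B D) :
  mono j -> is_kernel p i -> is_kernel (compose j p) i.
Proof.
move=> mj [pi0 uniq]; split=> [|X h jph0]; first by rewrite -compA pi0 compm0.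
by apply: uniq; apply: mj; rewrite compA jph0 compm0.
Qed.

Lemma kernel_of_comp_mono A E B D (p : hom E B) (i : hom A E) (j : hom B D) :
  mono j -> is_kernel (compose j p) i -> is_kernel p i.
Proof.
move=> mj [jpi0 uniq]; split=> [|X h ph0].
  by apply: mj; rewrite compA jpi0 compm0.
by apply: uniq; rewrite -compA ph0 compm0.
Qed.

(** Objects are chosen in two independent directions from M, along the two
    constructors of int; the relation S is only stated once both are fixed, so
    that no transport along equations between integers is needed. *)
Lemma int_sequence (P : C -> Prop) (S : C -> C -> Prop) M :
  P M -> (forall A, P A -> exists2 B, P B & S A B) ->
  (forall B, P B -> exists2 A, P A & S A B) ->
  exists2 N : int -> C, N 0 = M & forall i, S (N i) (N (i + 1)).
Proof.
move=> PM right left.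
pose T := {A | P A}.
have /choice[r rP] : forall A : T, exists B : T, S (sval A) (sval B).
  by move=> [A PA]; have [B PB SAB] := right A PA; exists (exist _ B PB).
have /choice[l lP] : forall B : T, exists A : T, S (sval A) (sval B).
  by move=> [B PB]; have [A PA SAB] := left B PB; exists (exist _ A PA).
pose N (i : int) : T :=
  match i with
  | Posz n => iter n r (exist _ M PM)
  | Negz n => iter n.+1 l (exist _ M PM)
  end.
exists (fun i => sval (N i)) => // -[n|[|n]].
- by rewrite -PoszD addn1 /=; apply: rP.
- exact: lP.
- have -> : Negz n.+1 + 1 = Negz n.
    by rewrite !NegzE -[n.+2]addn1 PoszD opprD addrNK.
  exact: lP.
Qed.

(** Splicing: the chosen sequences N_i -> E_i -> N_(i+1) compose to the
    differentials E_i -> N_(i+1) -> E_(i+1), whose image and kernel are the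
    N_i; properness is exactly what keeps the complex exact under Hom(J, -). *)
Lemma gorenstein_injective_coind (P : C -> Prop) M :
  (forall N, P N -> right_step P N) -> (forall N, P N -> left_step P N) ->
  P M -> gorenstein_injective M.
Proof.
move=> right left PM.
pose S A B := exists E (i : hom A E) (p : hom E B),
  injective_object E /\ proper_ses i p.
have [| |N N0 NS] := @int_sequence P S M PM.
- by move=> A /right[E [B [i [p [injE PB ip]]]]]; exists B => //; exists E, i, p.
- by move=> B /left[A [E [i [p [injE PB ip]]]]]; exists A => //; exists E, i, p.
subst M.
pose E i := sval (cid (NS i)).
pose inc i : hom (N i) (E i) := sval (cid (svalP (cid (NS i)))).
pose pr i : hom (E i) (N (i + 1)) := sval (cid (svalP (cid (svalP (cid (NS i)))))).
have EP i : injective_object (E i) /\ proper_ses (inc i) (pr i).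
  exact: svalP (cid (svalP (cid (svalP (cid (NS i)))))).
have kd i : is_kernel (compose (inc (i + 1)) (pr i)) (inc i).
  have [_ [kip _ _]] := EP i; have [_ [ki1 _ _]] := EP (i + 1).
  exact: kernel_comp_mono (kernel_mono ki1) kip.
exists E, (fun i => compose (inc (i + 1)) (pr i)), (inc 0); split=> //.
- by move=> i; case: (EP i).
- move=> i; exists (N (i + 1)), (inc (i + 1)), (pr i).
  by split=> //; case: (EP i) => _ [].
move=> J injJ i h; have [_ [_ _ lift]] := EP i.
have [kd0 kdu] := kd (i + 1); split=> [/kdu[v [<- _]] | [u <-]].
  by have [u <-] := lift J injJ v; exists u; rewrite compA.
by rewrite -[compose (compose (inc (i + 1)) _) u]compA compA kd0 comp0m.
Qed.

(** The cycles of a complete resolution are a class as in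
    [gorenstein_injective_coind], so each of them is Gorenstein injective, and
    a lift of J -> N_(i+1) to E_i is a preimage under Hom(J, d_i). *)
Lemma gorenstein_injective_steps M : gorenstein_injective M ->
  right_step (@gorenstein_injective C) M /\ left_step (@gorenstein_injective C) M.
Proof.
move=> [E [d [iota [injE exE kM hexE]]]].
pose P N := exists i (k : hom N (E i)), is_kernel (d i) k.
have lift i K (k : hom K (E (i + 1))) (e : hom (E i) K) :
    is_kernel (d (i + 1)) k -> d i = compose k e -> inj_lifting e.
  move=> kk de J injJ h.
  have [|u uP] := (hexE J injJ i (compose k h)).1.
    by rewrite compA kk.1 comp0m.
  by exists u; apply: (kernel_mono kk); rewrite compA -de.
have right N : P N -> right_step P N.
  move=> [i [k kk]]; have [K [k' [e [kk' epie de]]]] := exE i.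
  exists (E i), K, k, e; split=> //; first by exists (i + 1), k'.
  split=> //; last exact: lift kk' de.
  by apply: (kernel_of_comp_mono (kernel_mono kk')); rewrite -de.
have left N : P N -> left_step P N.
  move=> [i [k kk]]; have [j ij] : exists j, i = j + 1.
    by exists (i - 1); rewrite subrK.
  subst i; have [K [k' [e [kk' epie de]]]] := exE j.
  (* N and the image K of d_j are both kernels of d_(j+1), hence isomorphic. *)
  have [u [ku _]] := kk.2 K k' kk'.1; have [w [kw _]] := kk'.2 N k kk.1.
  have uw : compose u w = idm N.
    by apply: (kernel_mono kk); rewrite compA ku kw compm1.
  have dj : d j = compose k (compose u e) by rewrite compA ku.
  have [l jl] : exists l, j = l + 1 by exists (j - 1); rewrite subrK.
  subst j; have [K' [k1 [e' [kk1 _ _]]]] := exE l.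
  exists K', (E (l + 1)), k1, (compose u e).
  split=> //; first by exists (l + 1), k1.
  split; last exact: lift kk dj.
    by apply: (kernel_of_comp_mono (kernel_mono kk)); rewrite -dj.
  move=> X f g; rewrite !compA => /epie fg.
  by rewrite -[f]compm1 -[g]compm1 -uw !compA fg.
have PG N : P N -> gorenstein_injective N by exact: gorenstein_injective_coind.
have PM : P M by exists 0, iota.
split.
  have [A [B [i [p [injA PB ip]]]]] := right M PM.
  by exists A, B, i, p; split=> //; apply: PG.
have [A [B [i [p [injA PB ip]]]]] := left M PM.
by exists A, B, i, p; split=> //; apply: PG.
Qed.

End ProperExactness.

(** * Submodules, quotients and morphisms of modules *)

Section Submodules.
Variables (R : pzRingType) (U : lmodType R).

Record submodule := Submodule {
  in_submodule :> U -> Prop;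
  submodule0 : in_submodule 0;
  submoduleP : forall a x y,
    in_submodule x -> in_submodule y -> in_submodule (a *: x + y) }.

Lemma submoduleN (S : submodule) x : S x -> S (- x).
Proof.
by move=> Sx; rewrite -scaleN1r -[_ *: _]addr0; apply: submoduleP; last exact: submodule0.
Qed.

Lemma submoduleD (S : submodule) x y : S x -> S y -> S (x + y).
Proof. by move=> Sx Sy; rewrite -[x]scale1r; apply: submoduleP. Qed.

Lemma submoduleZ (S : submodule) a x : S x -> S (a *: x).
Proof. by move=> Sx; rewrite -[_ *: _]addr0; apply: submoduleP; last exact: submodule0. Qed.

Variable S : submodule.

Definition submodule_pred : {pred U} := fun x => `[< S x >].

Fact submodule_pred_closed : submod_closed submodule_pred.
Proof.
split=> [|a x y]; rewrite !unfold_in; first exact/asboolP/submodule0.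
by move=> /asboolP Sx /asboolP Sy; apply/asboolP/submoduleP.
Qed.

HB.instance Definition _ :=
  GRing.isSubmodClosed.Build R U submodule_pred submodule_pred_closed.

Record submod := Submod { submod_val : U; _ : submod_val \in submodule_pred }.
HB.instance Definition _ := [isSub for submod_val].
HB.instance Definition _ := [Choice of submod by <:].
HB.instance Definition _ := [SubChoice_isSubLmodule of submod by <:].

Definition submod_incl : {linear submod -> U} := val.

Lemma submod_incl_inj : injective submod_incl.
Proof. exact: val_inj. Qed.

Lemma submod_inclP (x : submod) : S (submod_incl x).
Proof. by case: x => x /= /asboolP. Qed.

Lemma submod_lift x : S x -> exists y, submod_incl y = x.
Proof. by move=> /asboolP Sx; exists (Submod Sx). Qed.

(** The quotient module is the set of chosen coset representatives; choose
    depends only on the extension of its predicate, so two elements of the same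
    coset get the same representative. *)
Definition coset_repr (x : U) : U := choose (fun y => `[< S (y - x) >]) x.

Lemma coset_reprP x : S (coset_repr x - x).
Proof.
apply/asboolP/(@chooseP _ (fun y => `[< S (y - x) >])).
by rewrite subrr; apply/asboolP/submodule0.
Qed.

Lemma coset_repr_eq x y : S (x - y) -> coset_repr x = coset_repr y.
Proof.
move=> Sxy; rewrite /coset_repr.
have -> : (fun z => `[< S (z - x) >]) = (fun z => `[< S (z - y) >]).
  apply: funext => z; apply: asbool_equiv_eq; split=> Sz.
    by rewrite -(subrK x z) -addrA; apply: submoduleD.
  rewrite -(subrK y z) -addrA; apply: submoduleD => //.
  by rewrite -opprB; apply: submoduleN.
by apply: choose_id; apply/asboolP; rewrite ?subrr; [|exact: submodule0].
Qed.

Record quo := Quo { quo_val : U; _ : coset_repr quo_val == quo_val }.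
HB.instance Definition _ := [isSub for quo_val].
HB.instance Definition _ := [Choice of quo by <:].

Fact coset_repr_idem x : coset_repr (coset_repr x) == coset_repr x.
Proof. exact/eqP/coset_repr_eq/coset_reprP. Qed.

Definition coset (x : U) : quo := Quo (coset_repr_idem x).

Lemma coset_surj q : exists x, q = coset x.
Proof. by exists (val q); apply: val_inj; case: q => x /= /eqP ->. Qed.

Lemma coset_eq x y : coset x = coset y <-> S (x - y).
Proof.
split=> [/(congr1 val) /= e|Sxy]; last exact/val_inj/coset_repr_eq.
rewrite -(subrK (coset_repr x) x) -addrA {2}e.
apply: submoduleD (coset_reprP y).
by rewrite -opprB; apply/submoduleN/coset_reprP.
Qed.

Definition quo_zero := coset 0.
Definition quo_opp (q : quo) := coset (- val q).
Definition quo_add (p q : quo) := coset (val p + val q).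
Definition quo_scale (a : R) (q : quo) := coset (a *: val q).

Fact coset_opp x : quo_opp (coset x) = coset (- x).
Proof. by apply/coset_eq; rewrite -opprD; apply/submoduleN/coset_reprP. Qed.
Fact coset_add x y : quo_add (coset x) (coset y) = coset (x + y).
Proof. by apply/coset_eq; rewrite opprD addrACA; apply: submoduleD; apply: coset_reprP. Qed.
Fact coset_scale a x : quo_scale a (coset x) = coset (a *: x).
Proof. by apply/coset_eq; rewrite -scalerBr; apply/submoduleZ/coset_reprP. Qed.

Fact quo_addA : associative quo_add.
Proof.
move=> p q r; have [[x ->] [y ->] [z ->]] := And3 (coset_surj p) (coset_surj q) (coset_surj r).
by rewrite !coset_add addrA.
Qed.
Fact quo_addC : commutative quo_add.
Proof. by move=> p q; rewrite /quo_add addrC. Qed.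
Fact quo_add0 : left_id quo_zero quo_add.
Proof. by move=> p; have [x ->] := coset_surj p; rewrite coset_add add0r. Qed.
Fact quo_addN : left_inverse quo_zero quo_opp quo_add.
Proof. by move=> p; have [x ->] := coset_surj p; rewrite coset_opp coset_add addNr. Qed.

HB.instance Definition _ :=
  GRing.isZmodule.Build quo quo_addA quo_addC quo_add0 quo_addN.

Fact quo_scaleA a b q : quo_scale a (quo_scale b q) = quo_scale (a * b) q.
Proof. by have [x ->] := coset_surj q; rewrite !coset_scale scalerA. Qed.
Fact quo_scale1 : left_id 1 quo_scale.
Proof. by move=> q; have [x ->] := coset_surj q; rewrite coset_scale scale1r. Qed.
Fact quo_scaleDr : right_distributive quo_scale +%R.
Proof.
move=> a p q; have [x ->] := coset_surj p; have [y ->] := coset_surj q.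
have addE u v : coset u + coset v = coset (u + v) by exact: coset_add.
by rewrite addE !coset_scale addE scalerDr.
Qed.
Fact quo_scaleDl q : {morph quo_scale^~ q : a b / a + b}.
Proof.
move=> a b; have [x ->] := coset_surj q.
have addE u v : coset u + coset v = coset (u + v) by exact: coset_add.
by rewrite !coset_scale addE scalerDl.
Qed.

HB.instance Definition _ := GRing.Zmodule_isLmodule.Build R quo
  quo_scaleA quo_scale1 quo_scaleDr quo_scaleDl.

Fact coset_linear : linear coset.
Proof. by move=> a x y; rewrite -coset_add -coset_scale. Qed.

HB.instance Definition _ := GRing.isLinear.Build R U quo _ coset coset_linear.

Definition quo_proj : {linear U -> quo} := coset.

Lemma quo_proj_eq0 x : quo_proj x = 0 <-> S x.
Proof. by rewrite -[x in S x]subr0; apply: coset_eq. Qed.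

End Submodules.

Section LinearMaps.
Variable R : pzRingType.
Implicit Types U V W : lmodType R.

Lemma linear_fun U V (f : U -> V) :
  linear f -> exists F : {linear U -> V}, forall x, F x = f x.
Proof.
move=> fP; pose fM := GRing.isLinear.Build R U V _ f fP.
by exists (HB.pack f fM : {linear U -> V}).
Qed.

(** Linear maps are mostly obtained by diagram chasing from a relation that is
    linear, total and single-valued; single-valuedness need only be checked
    at 0. *)
Lemma linear_graph U V (G : U -> V -> Prop) :
  (forall a x y u v, G x u -> G y v -> G (a *: x + y) (a *: u + v)) ->
  (forall x, exists v, G x v) -> (forall v, G 0 v -> v = 0) ->
  exists f : {linear U -> V}, forall x, G x (f x).
Proof.
move=> Glin /choice[f fG] G0.
have Guniq x u v : G x u -> G x v -> u = v.
  move=> Gu Gv; apply/eqP; rewrite -subr_eq0; apply/eqP/G0.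
  by have := Glin (-1) x x v u Gv Gu; rewrite !scaleN1r addNr [- v + u]addrC.
have [a x y|F FE] := @linear_fun U V f.
  by apply: Guniq (fG _) _; apply: Glin; apply: fG.
by exists F => x; rewrite FE.
Qed.

Definition ker_lift U V (f : {linear U -> V}) x :
  f x = 0 -> exists k, ker_incl f k = x.
Proof. by move=> /eqP fx; exists (Ker (f := f) (ker_val := x) fx). Qed.

Lemma ker_inclP U V (f : {linear U -> V}) k : f (ker_incl f k) = 0.
Proof. by case: k => x /= /eqP. Qed.

Lemma ker_incl_inj U V (f : {linear U -> V}) : injective (ker_incl f).
Proof. exact: val_inj. Qed.

Fact lin_image0 U V (f : {linear U -> V}) : exists x, f x = 0.
Proof. by exists 0; rewrite linear0. Qed.

Fact lin_imageP U V (f : {linear U -> V}) a y z :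
  (exists x, f x = y) -> (exists x, f x = z) -> exists x, f x = a *: y + z.
Proof. by move=> [x <-] [t <-]; exists (a *: x + t); rewrite linearP. Qed.

Definition lin_image U V (f : {linear U -> V}) : submodule V :=
  Submodule (lin_image0 f) (@lin_imageP U V f).

Lemma LMod_monoP U V (f : {linear U -> V}) :
  @mono (LMod R) U V f <-> injective f.
Proof.
split=> [mf|injf X u v uv]; last first.
  apply: linear_ext => x; apply: injf.
  exact: (congr1 (fun F : {linear _ -> _} => F x) uv).
apply: raddf_inj => x /ker_lift[k <-].
have /(mf (ker f : lmodType R)) -> // :
    lin_comp f (ker_incl f) = lin_comp f (lin_zero (ker f) U).
by apply: linear_ext => y /=; rewrite linear0; apply: ker_inclP.
Qed.

(** An epimorphism is onto because the projection to the quotient by its image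
    and the zero map agree after composition with it. *)
Lemma LMod_epiP U V (f : {linear U -> V}) :
  @epi (LMod R) U V f <-> forall y, exists x, f x = y.
Proof.
split=> [ef y|surjf X u v uv]; last first.
  apply: linear_ext => y; have [x <-] := surjf y.
  exact: (congr1 (fun F : {linear _ -> _} => F x) uv).
pose Im := lin_image f; apply/(quo_proj_eq0 Im).
have /(ef (quo Im : lmodType R)) -> // :
    lin_comp (quo_proj Im) f = lin_comp (lin_zero V (quo Im)) f.
by apply: linear_ext => x /=; apply/(quo_proj_eq0 Im); exists x.
Qed.

Lemma LMod_kernelP U V W (p : {linear U -> V}) (i : {linear W -> U}) :
  @is_kernel (LMod R) U V p W i <->
  injective i /\ forall x, p x = 0 <-> exists w, i w = x.
Proof.
split=> [kpi|[injW ex]].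
  split=> [|x]; first by apply/LMod_monoP/(kernel_mono kpi).
  case: kpi => pi0 uniq; split=> [px0|[w <-]]; last first.
    exact: (congr1 (fun F : {linear _ -> _} => F w) pi0).
  have [|u [iu _]] := uniq (ker p : lmodType R) (ker_incl p).
    by apply: linear_ext => y /=; apply: ker_inclP.
  have [k <-] := ker_lift px0; exists (u k).
  exact: (congr1 (fun F : {linear _ -> _} => F k) iu).
split=> [|X h ph0].
  by apply: linear_ext => w /=; apply/ex; exists w.
have {}ph0 x : p (h x) = 0.
  exact: (congr1 (fun F : {linear _ -> _} => F x) ph0).
have [||v|u uP] := @linear_graph X W (fun x w => i w = h x).
- by move=> a x y w z; rewrite !linearP => -> ->.
- by move=> x; apply/ex.
- by rewrite linear0 -(linear0 i) => /injW.
exists u; split=> [|u' iu']; first exact: linear_ext.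
apply: linear_ext => x; apply: injW; rewrite uP.
by rewrite -(congr1 (fun F : {linear _ -> _} => F x) iu').
Qed.

End LinearMaps.

Section Factor.
Variable R : pzRingType.
Implicit Types A B D : lmodType R.

Lemma factor_injective A B D (g : {linear A -> B}) (j : {linear D -> B}) :
  injective j -> (forall x, exists y, j y = g x) ->
  exists m : {linear A -> D}, forall x, j (m x) = g x.
Proof.
move=> injj ex; apply: (@linear_graph R A D (fun x y => j y = g x)) => //.
  by move=> a x y u v ju jv; rewrite !linearP ju jv.
by move=> v; rewrite linear0 -(linear0 j) => /injj.
Qed.

Lemma factor_surjective A B D (g : {linear A -> B}) (p : {linear A -> D}) :
  (forall y, exists x, p x = y) -> (forall x, p x = 0 -> g x = 0) ->
  exists m : {linear D -> B}, forall x, m (p x) = g x.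
Proof.
move=> surjp kpg.
have [a x y u v [s <- <-] [t <- <-]|y|v [x /kpg -> ->]//|m mE] :=
  @linear_graph R D B (fun y b => exists2 x, p x = y & g x = b).
- by exists (a *: s + t); rewrite linearP.
- by have [x <-] := surjp y; exists (g x), x.
exists m => x; have [y pyx <-] := mE (p x).
apply/eqP; rewrite -subr_eq0 -linearB; apply/eqP/kpg.
by rewrite linearB /= pyx subrr.
Qed.

End Factor.

(** * Injective and Gorenstein injective modules *)

Definition injective_module (R : pzRingType) (E : lmodType R) : Prop :=
  @injective_object (LMod R) E.
Definition GI_module (R : pzRingType) (M : lmodType R) : Prop :=
  @gorenstein_injective (LMod R) M.

Section InjectiveModules.
Variable R : pzRingType.
Implicit Types A B E J K M N U V : lmodType R.

Lemma injective_module_extend E A B (i : {linear A -> B}) (f : {linear A -> E}) :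
  injective_module E -> injective i ->
  exists g : {linear B -> E}, forall x, g (i x) = f x.
Proof.
move=> injE /LMod_monoP mi; have [g gi] := injE A B i mi f.
by exists g => x; rewrite -gi.
Qed.

Lemma injective_moduleI E :
  (forall A B (i : {linear A -> B}) (f : {linear A -> E}), injective i ->
    exists g : {linear B -> E}, forall x, g (i x) = f x) ->
  injective_module E.
Proof.
move=> ext A B i /LMod_monoP inji f; have [g gi] := ext A B i f inji.
by exists g; apply: linear_ext.
Qed.

Lemma prodM_lift (I : Type) (F : I -> lmodType R) A (f : forall i, {linear A -> F i}) :
  exists g : {linear A -> prodM F}, forall x i, g x i = f i x.
Proof. by exists (to_prodM f). Qed.

Lemma prodM_proj (I : Type) (F : I -> lmodType R) i :
  exists p : {linear prodM F -> F i}, forall x, p x = x i.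
Proof. exact: linear_fun. Qed.

Lemma prodM_injective (I : Type) (F : I -> lmodType R) :
  (forall i, injective_module (F i)) -> injective_module (prodM F).
Proof.
move=> injF; apply: injective_moduleI => A B k f injk.
have /dchoice[g gP] : forall i, exists g : {linear B -> F i}, forall x, g (k x) = f x i.
  move=> i; have [p pE] := prodM_proj F i.
  have [g gE] := injective_module_extend (lin_comp p f) (injF i) injk.
  by exists g => x; rewrite gE /= pE.
have [G GE] := prodM_lift g; exists G => x.
by apply: functional_extensionality_dep => i; rewrite GE gP.
Qed.

Lemma pair_lift A U V (f : {linear A -> U}) (g : {linear A -> V}) :
  exists h : {linear A -> (U * V)%type}, forall x, h x = (f x, g x).
Proof. by apply: linear_fun => a x y; rewrite !linearP. Qed.

Lemma pair_map A B U V (f : {linear A -> U}) (g : {linear B -> V}) :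
  exists h : {linear (A * B)%type -> (U * V)%type},
    forall x, h x = (f x.1, g x.2).
Proof. by apply: linear_fun => a x y; rewrite !linearP. Qed.

Definition lin_fst U V : {linear (U * V)%type -> U} := fst.
Definition lin_snd U V : {linear (U * V)%type -> V} := snd.

Lemma pair_injective U V :
  injective_module U -> injective_module V -> injective_module (U * V)%type.
Proof.
move=> injU injV; apply: injective_moduleI => A B k f injk.
have [g gE] := injective_module_extend (lin_comp (lin_fst U V) f) injU injk.
have [h hE] := injective_module_extend (lin_comp (lin_snd U V) f) injV injk.
have [G GE] := pair_lift g h; exists G => x.
by rewrite GE gE hE /=; case: (f x).
Qed.

Lemma retract_injective E V (s : {linear V -> E}) (r : {linear E -> V}) :
  (forall x, r (s x) = x) -> injective_module E -> injective_module V.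
Proof.
move=> rs injE; apply: injective_moduleI => A B k f injk.
have [g gE] := injective_module_extend (lin_comp s f) injE injk.
by exists (lin_comp r g) => x /=; rewrite gE /= rs.
Qed.

Definition lifts_injectives U V (p : {linear U -> V}) : Prop :=
  forall J, injective_module J -> forall h : {linear J -> V},
    exists u : {linear J -> U}, forall x, p (u x) = h x.

Record module_ses A E B (i : {linear A -> E}) (p : {linear E -> B}) : Prop :=
  ModuleSes {
    ses_inj : injective i;
    ses_exact : forall x, p x = 0 <-> exists w, i w = x;
    ses_surj : forall y, exists x, p x = y }.

Lemma ses0 A E B (i : {linear A -> E}) (p : {linear E -> B}) :
  module_ses i p -> forall w, p (i w) = 0.
Proof. by move=> ip w; apply/(ses_exact ip); exists w. Qed.

Lemma proper_module_sesP A E B (i : {linear A -> E}) (p : {linear E -> B}) :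
  @proper_ses (LMod R) A E B i p <-> module_ses i p /\ lifts_injectives p.
Proof.
split=> [[/LMod_kernelP[inji ex] /LMod_epiP surjp lift]|[[inji ex surjp] lift]].
  split=> // J injJ h; have [u pu] := lift J injJ h.
  by exists u => x; rewrite -pu.
split; [exact/LMod_kernelP | exact/LMod_epiP|move=> J injJ h].
have [u pu] := lift J injJ h.
by exists u; apply: linear_ext.
Qed.

Lemma GI_module_right M : GI_module M ->
  exists E N (i : {linear M -> E}) (p : {linear E -> N}),
    [/\ injective_module E, GI_module N, module_ses i p & lifts_injectives p].
Proof.
move=> /gorenstein_injective_steps[[E [N [i [p [injE GN /proper_module_sesP[ip lp]]]]]] _].
by exists E, N, i, p.
Qed.

Lemma GI_module_left M : GI_module M ->
  exists N E (i : {linear N -> E}) (p : {linear E -> M}),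
    [/\ injective_module E, GI_module N, module_ses i p & lifts_injectives p].
Proof.
move=> /gorenstein_injective_steps[_ [N [E [i [p [injE GN /proper_module_sesP[ip lp]]]]]]].
by exists N, E, i, p.
Qed.

Lemma GI_module_coind (P : lmodType R -> Prop) :
  (forall M, P M -> exists E N (i : {linear M -> E}) (p : {linear E -> N}),
    [/\ injective_module E, P N, module_ses i p & lifts_injectives p]) ->
  (forall M, P M -> exists N E (i : {linear N -> E}) (p : {linear E -> M}),
    [/\ injective_module E, P N, module_ses i p & lifts_injectives p]) ->
  forall M, P M -> GI_module M.
Proof.
move=> right left M; apply: gorenstein_injective_coind => {}M /[dup] PM.
  move=> /right[E [N [i [p [injE PN ip lp]]]]]; exists E, N, i, p; split=> //.
  exact/proper_module_sesP.
move=> /left[N [E [i [p [injE PN ip lp]]]]]; exists N, E, i, p; split=> //.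
exact/proper_module_sesP.
Qed.

(** In other words, the extensions of an injective module by a Gorenstein
    injective one split.  Let K embed in an injective E, with quotient N, so
    that E -> N is proper.  The embedding extends to phi : A -> E, which makes A
    the pullback of B -> N <- E.  So a lift to A of h : J -> B amounts to a lift
    to E of the composite J -> B -> N, and that exists. *)
Lemma GI_kernel_lifts K A B (i : {linear K -> A}) (p : {linear A -> B}) :
  GI_module K -> module_ses i p -> lifts_injectives p.
Proof.
move=> /GI_module_right[E [N [j [e [injE _ je le]]]]] ip J injJ h.
have [phi phiE] := injective_module_extend j injE (ses_inj ip).
have ephi x : p x = 0 -> e (phi x) = 0.
  by move=> /(ses_exact ip)[k <-]; rewrite phiE (ses0 je).
(* psi is the composite of h with the map B -> N that phi induces. *)
have [|x|n|psi psiE] :=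
    @linear_graph R J N (fun x n => exists2 a, p a = h x & e (phi a) = n).
- move=> a x y u v [b pb <-] [c pc <-].
  by exists (a *: b + c); rewrite !linearP ?pb ?pc.
- by have [a pa] := ses_surj ip (h x); exists (e (phi a)), a.
- by rewrite linear0 => -[a /ephi -> ->].
have [u uE] := le J injJ psi.
have [|x|a|w wE] := @linear_graph R J A (fun x a => p a = h x /\ phi a = u x).
- by move=> a x y b c [pb fb] [pc fc]; rewrite !linearP pb pc fb fc.
- have [a pa ea] := psiE x.
  have /(ses_exact je)[k kE] : e (u x - phi a) = 0.
    by rewrite linearB /= uE ea subrr.
  exists (a + i k); rewrite !linearD /= (ses0 ip) addr0; split=> //.
  by rewrite phiE kE addrC subrK.
- rewrite !linear0 => -[/(ses_exact ip)[k <-]]; rewrite phiE => jk.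
  by rewrite (ses_inj je (etrans jk (esym (linear0 j)))) linear0.
by exists w => x; case: (wE x).
Qed.

(** The summand I is carried along the resolution as the trivial complex
    I = I, in whichever position it is needed. *)
Lemma GI_pair M I : GI_module M -> injective_module I -> GI_module (M * I)%type.
Proof.
pose P V := GI_module V \/ exists M I, [/\ GI_module M, injective_module I
   & V = (M * I)%type :> lmodType R].
move=> GM injI; apply: (@GI_module_coind P); last by right; exists M, I.
- move=> V [GV|[{injI GM}M [{}I [GM injI ->]]]].
    have [E [N [i [p [injE GN ip lp]]]]] := GI_module_right GV.
    by exists E, N, i, p; split=> //; left.
  have [E [N [i [p [injE GN ip lp]]]]] := GI_module_right GM.
  have [k kE] := pair_map i (lin_id I).
  exists (E * I)%type, N, k, (lin_comp p (lin_fst E I)).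
  split=> //; [exact: pair_injective|by left| |].
    split=> [[x a] [y b]|[x a]|y].
    - by rewrite !kE /= => -[/(ses_inj ip) -> ->].
    - split=> [/= /(ses_exact ip)[w <-]|[w <-]]; first by exists (w, a); rewrite kE.
      by rewrite kE /= (ses0 ip).
    - by have [x <-] := ses_surj ip y; exists (x, 0).
  move=> J injJ h; have [u uE] := lp J injJ h.
  have [w wE] := pair_lift u (lin_zero J I).
  by exists w => x; rewrite /= wE uE.
- move=> V [GV|[{injI GM}M [{}I [GM injI ->]]]].
    have [N [E [i [p [injE GN ip lp]]]]] := GI_module_left GV.
    by exists N, E, i, p; split=> //; left.
  have [N [E [i [p [injE GN ip lp]]]]] := GI_module_left GM.
  have [k kE] := pair_map p (lin_id I).
  have [j jE] := pair_lift i (lin_zero N I).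
  exists N, (E * I)%type, j, k.
  split=> //; [exact: pair_injective|by left| |].
    split=> [x y|[x a]|[y a]].
    - by rewrite !jE /= => -[/(ses_inj ip)].
    - rewrite kE; split=> [/= [/(ses_exact ip)[w <-] ->]|[w]]; first by exists w; rewrite jE.
      by rewrite jE /= => -[<- <-]; rewrite (ses0 ip).
    - by have [x <-] := ses_surj ip y; exists (x, a); rewrite kE.
  move=> J injJ h; have [u uE] := lp J injJ (lin_comp (lin_fst M I) h).
  have [w wE] := pair_lift u (lin_comp (lin_snd M I) h).
  by exists w => x; rewrite kE wE /= uE /=; case: (h x).
Qed.

End InjectiveModules.

(** * Baer's criterion and direct sums over noetherian rings *)

Section Baer.
Variable R : pzRingType.
Implicit Types A B E : lmodType R.

Definition functional_graph A E (G : A * E -> Prop) : Prop :=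
  (forall a x y, G x -> G y -> G (a *: x + y)) /\ (forall e, G (0, e) -> e = 0).

(** Baer's condition; a map from a left ideal to E is encoded by its graph, a
    functional submodule of R * E, so that no type for the ideal is needed. *)
Definition baer E : Prop :=
  forall G : R^o * E -> Prop, G 0 -> functional_graph G ->
    exists e0 : E, forall r e, G (r, e) -> e = (r : R) *: e0.

Lemma injective_baer E : injective_module E -> baer E.
Proof.
move=> injE G G0 [Glin Gfun]; pose S := Submodule G0 Glin.
pose k := lin_comp (lin_fst (R^o : lmodType R) E) (submod_incl S).
have injk : injective k.
  apply: raddf_inj => x k0; apply: submod_incl_inj; rewrite linear0.
  by have := submod_inclP x; move: k0; rewrite /k /=; case: (submod_val x) => r e /= -> /Gfun ->.
have [g gE] := injective_module_extend
  (lin_comp (lin_snd (R^o : lmodType R) E) (submod_incl S)) injE injk.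
exists (g (1 : R^o)) => r e /(submod_lift (S := S))[x xE].
have := gE x; rewrite /= in xE *; rewrite xE /= => <-.
by rewrite -linearZ /=; congr (g _); rewrite /GRing.scale /= mulr1.
Qed.

(** A maximal partial extension of f, given as a graph, is total: to define it
    at b, the condition is applied to the ideal of the scalars r such that r b
    already lies in its domain. *)
Lemma baer_injective E : baer E -> injective_module E.
Proof.
move=> baerE; apply: injective_moduleI => A B k f injk.
pose gr (z : B * E) := exists x, z = (k x, f x).
have gr_lin a y z : gr y -> gr z -> gr (a *: y + z).
  by move=> [u ->] [v ->]; exists (a *: u + v); rewrite !linearP.
(* Adjoining the graph gr of f makes the empty set admissible, as needed for
   the empty chain. *)
have [|X [[Glin Gfun] Xmax]] := @Zorn_bigcup (B * E)%type
  (fun X => functional_graph (fun z => X z \/ gr z)).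
- move=> F FP totF; split.
    move=> a y z [[X FX Xy]|gy] [[Y FY Yz]|gz].
    + have [XY|YX] := totF X Y FX FY.
        have [||w|w] := (FP Y FY).1 a y z; [by left; apply: XY|by left| |by right].
        by left; exists Y.
      have [||w|w] := (FP X FX).1 a y z; [by left|by left; apply: YX| |by right].
      by left; exists X.
    + have [||w|w] := (FP X FX).1 a y z; [by left|by right| |by right].
      by left; exists X.
    + have [||w|w] := (FP Y FY).1 a y z; [by right|by left| |by right].
      by left; exists Y.
    + by right; apply: gr_lin.
  move=> e [[X FX Xe]|[x [kx ->]]]; first by apply: (FP X FX).2; left.
  by rewrite (injk x 0) ?linear0.
pose G z := X z \/ gr z.
have G0 : G 0 by right; exists 0; rewrite !linear0.
have Gtot b : exists e, G (b, e).
  have [| |e0 e0P] := baerE (fun z : R^o * E => G ((z.1 : R) *: b, z.2)).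
  - by rewrite scale0r.
  - split=> [a [r e] [s e'] /= Gr Gs|e]; last by rewrite scale0r; apply: Gfun.
    have := Glin a _ _ Gr Gs; congr G; congr (_, _).
    by rewrite /= scalerDl scalerA.
  pose G' z := exists r x e, G (x, e) /\ z = (x + r *: b, e + r *: e0).
  have GG' z : G z -> G' z.
    by case: z => x e Gz; exists 0, x, e; rewrite !scale0r !addr0.
  have G'b : G' (b, e0) by exists 1, 0, 0; rewrite !scale1r !add0r.
  exists e0; left; apply: contrapT => nXb.
  apply: (Xmax G'); first by split=> [z Xz|/(_ _ G'b)//]; apply: GG'; left.
  have G'E z : G' z \/ gr z -> G' z by move=> [//|gz]; apply: GG'; right.
  split=> [a y z /G'E[r [x [e [Gx ->]]]] /G'E[s [x' [e' [Gx' ->]]]]|e /G'E].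
    left; exists (a * r + s), (a *: x + x'), (a *: e + e'); split.
      exact: Glin Gx Gx'.
    by congr (_, _); rewrite /= scalerDr scalerDl !scalerA addrACA.
  move=> [r [x [e' [Gx [/eqP]]]]]; rewrite eq_sym addrC addr_eq0 => /eqP rb ->.
  have := Glin (-1) _ _ Gx G0; rewrite addr0 => Gr.
  rewrite -(e0P r (- e')) ?subrr //=.
  by rewrite rb -!scaleN1r.
have [|//||g gE] := @linear_graph R B E (fun b e => G (b, e)).
- by move=> a x y u v; apply: Glin.
- exact: Gfun.
exists g => x; apply/eqP; rewrite -subr_eq0; apply/eqP/Gfun.
have Gx : G (k x, f x) by right; exists x.
have := Glin (-1) _ _ Gx (gE (k x)); congr G; congr (_, _); rewrite /= scaleN1r.
  by rewrite addNr.
by rewrite addrC.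
Qed.

End Baer.

Section DirectSum.
Variables (R : pzRingType) (L : choiceType) (I : lmodType R).

Let P : lmodType R := prodM (fun _ : L => I).

Definition finite_support (x : P) : Prop :=
  exists s : seq L, forall l, l \notin s -> x l = 0.

Fact finite_support0 : finite_support 0.
Proof. by exists [::]. Qed.

Fact finite_supportP a x y :
  finite_support x -> finite_support y -> finite_support (a *: x + y).
Proof.
move=> [s xs] [t yt]; exists (s ++ t) => l; rewrite mem_cat negb_or => /andP[ls lt].
have -> : (a *: x + y) l = a *: x l + y l by [].
by rewrite xs // yt // scaler0 addr0.
Qed.

Definition finite_supports : submodule P :=
  Submodule finite_support0 finite_supportP.

Definition direct_sum : lmodType R := submod finite_supports.

Definition single_fun (l : L) (x : I) : P := fun m => if m == l then x else 0.

Lemma single_exists l : exists inc : {linear I -> direct_sum},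
  forall x, submod_incl finite_supports (inc x) = single_fun l x.
Proof.
apply: (@linear_graph R I direct_sum
    (fun x v => submod_incl finite_supports v = single_fun l x)) => [a x y u v ux vy|x|v].
- rewrite linearP ux vy; apply: functional_extensionality_dep => m.
  have -> : (a *: single_fun l x + single_fun l y) m
     = a *: single_fun l x m + single_fun l y m by [].
  by rewrite /single_fun; case: ifP => // _; rewrite scaler0 addr0.
- have := @submod_lift R P finite_supports (single_fun l x); apply.
  exists [:: l] => m.
  by rewrite inE /single_fun => /negPf ->.
move=> v0; apply: (@submod_incl_inj _ _ finite_supports).
rewrite v0 linear0; apply: functional_extensionality_dep => m.
by rewrite /single_fun; case: ifP.
Qed.

Definition single l : {linear I -> direct_sum} := sval (cid (single_exists l)).

Lemma singleE l x m :
  submod_incl finite_supports (single l x) m = if m == l then x else 0.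
Proof. by rewrite (svalP (cid (single_exists l))). Qed.

Lemma sum_support (V : lmodType R) (g : L -> V) (s t : seq L) :
  uniq s -> uniq t -> {subset t <= s} -> (forall l, l \notin t -> g l = 0) ->
  \sum_(l <- s) g l = \sum_(l <- t) g l.
Proof.
move=> us ut ts g0; rewrite (bigID (mem t)) /= [X in _ + X]big1 ?addr0; last first.
  by move=> l; apply: g0.
rewrite -big_filter; apply: perm_big; apply: uniq_perm => [||l]; rewrite ?filter_uniq //.
by rewrite mem_filter; apply: andb_idr => /ts.
Qed.

(** The required map sends x to the sum of the g l (x l) over the support of x.
    The relation asks for this sum over all large enough finite index sets,
    which makes it visibly linear. *)
Lemma direct_sum_desc (N : lmodType R) (g : L -> {linear I -> N}) :
  exists h : {linear direct_sum -> N}, forall l x, h (single l x) = g l x.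
Proof.
pose val (x : direct_sum) : P := submod_incl finite_supports x.
pose G x v := exists s0 : seq L, forall s, uniq s -> {subset s0 <= s} ->
  v = \sum_(l <- s) g l (val x l).
have [a x y u v [s xs] [t yt]|x|v [s vs]|h hE] := @linear_graph R direct_sum N G.
- exists (s ++ t) => r ur str.
  rewrite (xs r ur) ?(yt r ur) => [|l lt|l ls]; first last.
  + by apply: str; rewrite mem_cat ls.
  + by apply: str; rewrite mem_cat lt orbT.
  rewrite scaler_sumr -big_split /=; apply: eq_bigr => l _.
  by rewrite -linearP.
- have [s xs] := submod_inclP x; exists (\sum_(l <- undup s) g l (val x l)), s.
  move=> t ut st; apply/esym/sum_support; rewrite ?undup_uniq // => l.
    by rewrite mem_undup => /st.
  by rewrite mem_undup => /xs; rewrite /val => ->; rewrite linear0.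
- rewrite (vs (undup s)) ?undup_uniq //; last by move=> l; rewrite mem_undup.
  by apply: big1 => l _; rewrite /val linear0.
exists h => l x; have [s hs] := hE (single l x).
rewrite (hs (undup (l :: s))) ?undup_uniq //; last first.
  by move=> m ms; rewrite mem_undup inE ms orbT.
rewrite (@sum_support _ _ _ [:: l]) ?undup_uniq //.
- by rewrite big_seq1 /val singleE eqxx.
- by move=> m; rewrite mem_undup !inE => ->.
by move=> m; rewrite inE /val singleE => /negPf ->; rewrite linear0.
Qed.

Lemma direct_sum_ext (N : lmodType R) (h k : {linear direct_sum -> N}) :
  (forall l x, h (single l x) = k (single l x)) -> forall x, h x = k x.
Proof.
move=> hk x; have [s xs] := submod_inclP x.
pose y : P := submod_incl finite_supports x.
suff -> : x = \sum_(l <- undup s) single l (y l).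
  by rewrite !linear_sum; apply: eq_bigr => l _; apply: hk.
apply: (@submod_incl_inj _ _ finite_supports); rewrite linear_sum.
apply: functional_extensionality_dep => m.
have [p pE] := prodM_proj (fun _ : L => I) m.
rewrite -!pE linear_sum (eq_bigr (fun l => if m == l then y l else 0)); last first.
  by move=> l _; rewrite -singleE -pE.
have [ms|ms] := boolP (m \in s).
  rewrite (@sum_support _ _ _ [:: m]) ?undup_uniq //.
  - by rewrite big_seq1 eqxx pE.
  - by move=> l; rewrite mem_undup inE => /eqP ->.
  by move=> l; rewrite inE eq_sym => /negPf ->.
rewrite pE xs // big_seq big1 // => l; rewrite mem_undup.
by case: eqP ms => // -> /negPf ->.
Qed.

(** A map from a left ideal to the direct sum is multiplication by some e in the
    full product, which is injective.  The elements of the ideal that kill all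
    coordinates of e outside a finite set F form a left ideal; by the ascending
    chain condition some F gives the whole ideal, and e may then be replaced by
    its restriction to F. *)
Lemma direct_sum_injective :
  noetherian_module (R^o : lmodType R) -> injective_module I ->
  injective_module direct_sum.
Proof.
move=> noeth injI; apply: baer_injective => G G0 [Glin Gfun].
pose val (x : direct_sum) : P := submod_incl finite_supports x.
have injP : injective_module P by exact: prodM_injective.
have [|| e eP] := injective_baer injP
    (G := fun z : R^o * P => exists2 s, G (z.1, s) & z.2 = val s).
- by exists 0.
- split=> [a [r x] [r' x'] /= [s Gs ->] [s' Gs' ->]|x /= [s /Gfun -> ->]].
    by exists (a *: s + s'); [exact: (Glin a (r, s) (r', s'))|rewrite /val linearP].
  by rewrite /val linear0.
pose dom (r : R) := exists s, G (r, s).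
have supp (r : R) s : G (r, s) -> forall l, val s l = r *: e l.
  by move=> Grs l; rewrite (eP r (val s)) //; exists s.
have [F FP] : exists F : seq L, forall (r : R) l, dom r -> l \notin F -> r *: e l = 0.
  apply: contrapT => /forallNP noF.
  have /choice[next nextP] : forall F : seq L, exists F' : seq L,
      {subset F <= F'} /\ exists r : R, [/\ dom r, forall l, l \notin F' -> r *: e l = 0
        & exists2 l, l \notin F & r *: e l <> 0].
    move=> F; have /existsNP[r /existsNP[l /not_implyP[[s Gs] /not_implyP[lF rl]]]] := noF F.
    have [t st] := submod_inclP s; exists (F ++ t); split.
      by move=> m mF; rewrite mem_cat mF.
    exists r; split; [by exists s| |by exists l].
    move=> m; rewrite mem_cat negb_or => /andP[_ mt].
    by rewrite -(supp r s Gs) /val st.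
  pose T n : {pred R^o} := fun r =>
    `[< dom r /\ forall l, l \notin iter n next [::] -> (r : R) *: e l = 0 >].
  have [n|n r|N NP] := noeth T.
  - split; first by apply/asboolP; split=> [|l _]; [by exists 0|rewrite scale0r].
    move=> a r r' /asboolP[[s Gs] rs] /asboolP[[s' Gs'] rs']; apply/asboolP.
    split=> [|l lF]; first by exists (a *: s + s'); apply: (Glin a (r, s) (r', s')).
    by rewrite scalerDl [a *: r]/(a * r) -scalerA rs // rs' // scaler0 addr0.
  - move=> /asboolP[dr rn]; apply/asboolP; split=> // l.
    have [sub _] := nextP (iter n next [::]) => lF; apply: rn.
    by apply: contra lF => /sub.
  have [_ [r [dr rF [l lF rl]]]] := nextP (iter N next [::]).
  have /asboolP[_ /(_ l lF)//] : r \in T N.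
  by rewrite -(NP N.+1) //; apply/asboolP.
have [e' e'E] : exists e' : direct_sum,
    val e' = (fun l => if l \in F then e l else 0) :> P.
  have := @submod_lift R P finite_supports (fun l => if l \in F then e l else 0).
  by apply; exists F => l /negPf ->.
exists e' => r s Gs; apply: (@submod_incl_inj _ _ finite_supports).
rewrite linearZ; apply: functional_extensionality_dep => l.
suff : val s l = (r : R) *: val e' l by [].
rewrite e'E (supp r s Gs); case: ifPn => // lF.
by rewrite scaler0 FP //; exists s.
Qed.

End DirectSum.

Lemma injective_coproduct (R : pzRingType) (I : lmodType R) (L : Type) :
  noetherian_module (R^o : lmodType R) -> injective_module I ->
  exists (S : lmodType R) (inc : L -> {linear I -> S}),
    [/\ injective_module S,
        forall (N : lmodType R) (g : L -> {linear I -> N}),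
          exists h : {linear S -> N}, forall l x, h (inc l x) = g l x
      & forall (N : lmodType R) (h k : {linear S -> N}),
          (forall l x, h (inc l x) = k (inc l x)) -> forall x, h x = k x].
Proof.
elim/Pchoice: L => L noeth injI.
exists (direct_sum L I), (@single R L I); split.
- exact: direct_sum_injective.
- exact: direct_sum_desc.
exact: direct_sum_ext.
Qed.

(** * Exactness and injectivity for representations *)

Section Reps.
Variables (Q : quiver) (R : pzRingType).
Implicit Types X Y Z M : rep Q R.

Definition injective_rep X : Prop := @injective_object (RepCat Q R) X.
Definition locally_injective X : Prop := forall v, injective_module (X v).

Lemma rep_hom_eq X Y (f g : rep_hom X Y) : f = g -> forall v x, f v x = g v x.
Proof. by move=> ->. Qed.

(** A proof of s(a) = s(a) is reflexivity, by proof irrelevance; this lets the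
    arrows leaving v be treated as arrows whose source is v by definition. *)
Lemma rep_out_mapE X (a : arrow Q) (e : src a = src a) :
  rep_out_map X (exist (fun b => src b = src a) a e) = rep_map X a.
Proof.
rewrite /rep_out_map; move: (svalP (exist (fun b => src b = src a) a e)) => /= p.
by rewrite (Prop_irrelevance p erefl).
Qed.

Lemma rep_out_natural X Y (f : rep_hom X Y) v (a : out_arrow v) x :
  f (tgt (sval a)) (rep_out_map X a x) = rep_out_map Y a (f v x).
Proof.
case: a => a e; case: v / e x => x; rewrite !rep_out_mapE.
exact: (rep_hom_natural f).
Qed.

Lemma injective_rep_extend X A B (i : rep_hom A B) (f : rep_hom A X) :
  injective_rep X -> (forall v, injective (i v)) ->
  exists g : rep_hom B X, forall v x, g v (i v x) = f v x.
Proof.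
move=> injX inji; have mi : @mono (RepCat Q R) A B i.
  move=> T u w uw; apply: rep_hom_ext => v x; apply: inji.
  exact: (rep_hom_eq uw).
by have [g gi] := injX A B i mi f; exists g => v x; rewrite -gi.
Qed.

Lemma rep_epi_surjective X Y (f : rep_hom X Y) :
  @epi (RepCat Q R) X Y f -> forall v y, exists x, f v x = y.
Proof.
move=> ef v0 y0.
pose im v := lin_image (f v).
have /dchoice[m mE] : forall a : arrow Q,
    exists m : {linear quo (im (src a)) -> quo (im (tgt a))},
    forall y, m (quo_proj (im (src a)) y) = quo_proj (im (tgt a)) (rep_map Y a y).
  move=> a.
  apply: (factor_surjective (g := lin_comp (quo_proj (im (tgt a))) (rep_map Y a))).
    by move=> q; have [y ->] := coset_surj q; exists y.
  move=> y /quo_proj_eq0[x <-] /=; apply/(quo_proj_eq0 (im (tgt a))).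
  by exists (rep_map X a x); rewrite rep_hom_natural.
pose C := @Rep Q R (fun v => quo (im v)) m.
pose p : rep_hom Y C := @RepHom Q R Y C (fun v => quo_proj (im v)) (fun a y => esym (mE a y)).
apply/(quo_proj_eq0 (im v0)).
have /ef pE : rep_comp p f = rep_comp (rep_zero Y C) f.
  by apply: rep_hom_ext => v x /=; apply/(quo_proj_eq0 (im v)); exists x.
exact: (rep_hom_eq (pE : p = rep_zero Y C)).
Qed.

Definition rep_ses X Y Z (i : rep_hom X Y) (p : rep_hom Y Z) : Prop :=
  forall v, module_ses (i v) (p v).

Definition rep_lifts Y Z (p : rep_hom Y Z) : Prop :=
  forall J, injective_rep J -> forall h : rep_hom J Z,
    exists u : rep_hom J Y, forall v x, p v (u v x) = h v x.

(** The vertexwise kernels of p form a representation, and it is isomorphic to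
    any kernel X of p in the category. *)
Lemma rep_kernel_exact X Y Z (i : rep_hom X Y) (p : rep_hom Y Z) :
  @is_kernel (RepCat Q R) Y Z p X i ->
  forall v, injective (i v) /\ forall x, p v x = 0 <-> exists w, i v w = x.
Proof.
move=> [pi0 uniq].
have /dchoice[m mE] : forall a : arrow Q,
    exists m : {linear ker (p (src a)) -> ker (p (tgt a))},
    forall k, ker_incl (p (tgt a)) (m k) = rep_map Y a (ker_incl (p (src a)) k).
  move=> a; apply: (factor_injective (g := lin_comp (rep_map Y a) (ker_incl _))).
    exact: ker_incl_inj.
  move=> k; apply: ker_lift => /=.
  by rewrite rep_hom_natural [p _ _]ker_inclP linear0.
pose K := @Rep Q R (fun v => ker (p v)) m.
pose k : rep_hom K Y := @RepHom Q R K Y (fun v => ker_incl (p v)) mE.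
have [|u [iu _]] := uniq K k.
  by apply: rep_hom_ext => v x; apply: ker_inclP.
have {}iu v x : i v (u v x) = ker_incl (p v) x by exact: (rep_hom_eq iu).
have {}pi0 v x : p v (i v x) = 0 by exact: (rep_hom_eq pi0).
have [l lE] : exists l : rep_hom X K, forall v x, ker_incl (p v) (l v x) = i v x.
  have /dchoice[l lE] : forall v, exists l : {linear X v -> ker (p v)},
      forall x, ker_incl (p v) (l x) = i v x.
    move=> v; apply: factor_injective; first exact: ker_incl_inj.
    by move=> x; apply/ker_lift/pi0.
  have lN a x : l (tgt a) (rep_map X a x) = rep_map K a (l (src a) x).
    by apply: (@ker_incl_inj _ _ _ (p (tgt a))); rewrite lE rep_hom_natural mE lE.
  by exists (@RepHom Q R X K l lN).
have ul v x : u v (l v x) = x.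
  have ic : rep_comp i (rep_comp u l) = rep_comp i (rep_id X).
    by apply: rep_hom_ext => w y; rewrite /= iu lE.
  have [|w [_ wu]] := uniq X i; first exact: rep_hom_ext.
  have i1 := compm1 (c := RepCat Q R) (A := X) (B := Y) i.
  have e := wu (rep_comp u l) (etrans ic i1).
  exact: (rep_hom_eq (etrans (esym e) (wu (rep_id X) i1))).
move=> v; split=> [|x].
  apply: raddf_inj => x ix0; rewrite -[x]ul.
  suff -> : l v x = 0 by rewrite linear0.
  by apply: (@ker_incl_inj _ _ _ (p v)); rewrite lE ix0 linear0.
split=> [/ker_lift[w <-]|[w <-]]; last exact: pi0.
by exists (u v w).
Qed.

Lemma proper_rep_sesP X Y Z (i : rep_hom X Y) (p : rep_hom Y Z) :
  @proper_ses (RepCat Q R) X Y Z i p <-> rep_ses i p /\ rep_lifts p.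
Proof.
split=> [[/rep_kernel_exact kip /rep_epi_surjective surjp lift]|[ip lift]].
  split; first by move=> v; case: (kip v) => injv exv; split.
  move=> J injJ h; have [u pu] := lift J injJ h.
  by exists u; apply: (rep_hom_eq pu).
split.
- split=> [|T h ph0].
    by apply: rep_hom_ext => v x; apply: (ses0 (ip v)).
  have /dchoice[u uE] : forall v, exists u : {linear T v -> X v}, forall x, i v (u x) = h v x.
    move=> v; apply: factor_injective; first exact: ses_inj (ip v).
    by move=> x; apply/(ses_exact (ip v)); exact: (rep_hom_eq ph0).
  have uN a x : u (tgt a) (rep_map T a x) = rep_map X a (u (src a) x).
    by apply: (ses_inj (ip (tgt a))); rewrite uE !rep_hom_natural uE.
  exists (@RepHom Q R T X u uN); split=> [|w iw].
    by apply: rep_hom_ext => v x; apply: uE.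
  apply: rep_hom_ext => v x; apply: (ses_inj (ip v)); rewrite /= uE.
  exact/esym/(rep_hom_eq iw).
- move=> T f g fg; apply: rep_hom_ext => v y.
  have [x <-] := ses_surj (ip v) y; exact: (rep_hom_eq fg).
move=> J injJ h; have [u pu] := lift J injJ h.
by exists u; apply: rep_hom_ext.
Qed.

End Reps.

(** * Extension of a representation by products over walks *)

Inductive walk (Q : quiver) : vertex Q -> Type :=
  | Walk1 (a : arrow Q) : walk (src a)
  | WalkS (a : arrow Q) : walk (tgt a) -> walk (src a).

Fixpoint walk_end (Q : quiver) (v : vertex Q) (w : walk v) : vertex Q :=
  match w with
  | Walk1 a => tgt a
  | WalkS _ w' => walk_end w'
  end.

Section Reps.
Variables (Q : quiver) (R : pzRingType).
Implicit Types X Z M : rep Q R.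
Implicit Type Y : vertex Q -> lmodType R.

Definition walk_prod Y (v : vertex Q) : lmodType R :=
  prodM (fun w : walk v => Y (walk_end w)).

(** A walk leaving v is an arrow, or an arrow followed by a walk; so a family
    over the walks leaving v is given by elements attached to the arrows leaving
    v and families over the walks that continue them. *)
Definition walk_cons Y v (w : walk v) :
    (forall a : out_arrow v, Y (tgt (sval a))) ->
    (forall a : out_arrow v, walk_prod Y (tgt (sval a))) -> Y (walk_end w) :=
  match w in walk u return (forall a : out_arrow u, Y (tgt (sval a))) ->
    (forall a : out_arrow u, walk_prod Y (tgt (sval a))) -> Y (walk_end w) with
  | Walk1 a => fun y _ => y (exist _ a erefl)
  | WalkS a w' => fun _ d => d (exist _ a erefl) w'
  end.

(** The representation with X(v) * prod_w Y(end w) at v, the product being over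
    the walks w leaving v.  Along an arrow a the coordinates of the walks
    starting with a are shifted, and the coordinate of a itself, which would be
    lost, is added to X(t(a)) through q. *)
Section WalkExtension.
Variables (X : rep Q R) (Y : vertex Q -> lmodType R).
Variable q : forall v, {linear Y v -> X v}.

Definition walk_ext_obj v : lmodType R := (X v * walk_prod Y v)%type.

Definition walk_ext_fun (a : arrow Q) (z : walk_ext_obj (src a)) :
    walk_ext_obj (tgt a) :=
  (rep_map X a z.1 + q (tgt a) (z.2 (Walk1 a)), fun w => z.2 (WalkS w)).

Fact walk_ext_linear a : linear (@walk_ext_fun a).
Proof.
move=> r x y; congr (_, _) => /=.
have -> : (r *: x.2 + y.2) (Walk1 a) = r *: x.2 (Walk1 a) + y.2 (Walk1 a) by [].
by rewrite !linearP scalerDr addrACA.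
Qed.

HB.instance Definition _ a := GRing.isLinear.Build R _ _ _
  (@walk_ext_fun a) (@walk_ext_linear a).

Definition walk_ext : rep Q R := @Rep Q R walk_ext_obj (@walk_ext_fun).

Lemma walk_ext_out v (a : out_arrow v) (x : X v) y d :
  rep_out_map walk_ext a (x, fun w => walk_cons w y d)
  = (rep_out_map X a x + q (tgt (sval a)) (y a), d a).
Proof.
case: a => a e; case: v / e x y d => x y d; rewrite !rep_out_mapE.
by [].
Qed.

Lemma walk_ext_locally_injective :
  locally_injective X -> (forall v, injective_module (Y v)) ->
  locally_injective walk_ext.
Proof.
by move=> injX injY v; apply: pair_injective => //; apply: prodM_injective.
Qed.

(** The coordinates of walks of length at least two absorb any target in the
    products of the next vertices, so only the components in X(t(a)) are left;
    they may be hit both from X(v) and, through q, from the coordinates of the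
    single arrows. *)
Lemma walk_ext_lifts :
  (forall v J, injective_module J ->
    forall g : forall a : out_arrow v, {linear J -> X (tgt (sval a))},
    exists (x : {linear J -> X v})
      (y : forall a : out_arrow v, {linear J -> Y (tgt (sval a))}),
    forall a t, rep_out_map X a (x t) + q (tgt (sval a)) (y a t) = g a t) ->
  forall v, lifts_injectives (out_map walk_ext v).
Proof.
move=> ext v J injJ h.
have /dchoice[pr prE] : forall a : out_arrow v,
    exists p : {linear out_prod walk_ext v -> walk_ext (tgt (sval a))}, forall x, p x = x a.
  by move=> a; apply: prodM_proj.
pose hx a := lin_comp (lin_fst _ _) (lin_comp (pr a) h).
pose hd a := lin_comp (lin_snd _ _) (lin_comp (pr a) h).
have [x [y xyE]] := ext v J injJ hx.
have /dchoice[c cE] : forall w : walk v, exists c : {linear J -> Y (walk_end w)},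
    forall t, c t = walk_cons w (fun a => y a t) (fun a => hd a t).
  move=> w; apply: linear_fun => r s t; move: y hd {xyE}.
  rewrite /walk_cons; case: v / w {ext h pr prE hx x} => [a|a w] y hd.
    exact: linearP.
  by rewrite linearP.
have [d dE] := prodM_lift c.
have [u uE] := pair_lift x d; exists u => t.
apply: functional_extensionality_dep => a.
have -> : u t = (x t, fun w => walk_cons w (fun a => y a t) (fun a => hd a t)).
  rewrite uE; congr (_, _); apply: functional_extensionality_dep => w.
  by rewrite dE cE.
rewrite -[LHS]/(rep_out_map walk_ext a _) walk_ext_out xyE /hx /hd /= prE.
by case: (h t a).
Qed.

End WalkExtension.

Lemma walk_ext_lifts_onto X Y (q : forall v, {linear Y v -> X v}) :
  (forall v, lifts_injectives (q v)) ->
  forall v, lifts_injectives (out_map (walk_ext q) v).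
Proof.
move=> lq; apply: walk_ext_lifts => v J injJ g.
have /dchoice[y yE] : forall a : out_arrow v, exists y : {linear J -> Y (tgt (sval a))},
    forall t, q _ (y t) = g a t.
  by move=> a; apply: lq.
exists (lin_zero J (X v)), y => a t.
by rewrite linear0 add0r yE.
Qed.

Lemma injective_repI X : source_injective_representation_quiver Q ->
  locally_injective X -> (forall v, lifts_injectives (out_map X v)) ->
  injective_rep X.
Proof.
move=> hQ injX lX; apply/hQ; split=> // v.
have injP : injective_module (out_prod X v) by apply: prodM_injective.
have [s sE] := lX v _ injP (lin_id _).
by exists s; apply: linear_ext => x; rewrite /= sE.
Qed.

Lemma injective_rep_local X : source_injective_representation_quiver Q ->
  injective_rep X -> locally_injective X.
Proof. by move=> hQ /hQ[]. Qed.

Lemma injective_rep_split X v : source_injective_representation_quiver Q ->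
  injective_rep X -> exists s : {linear out_prod X v -> X v},
    forall y, out_map X v (s y) = y.
Proof.
move=> hQ /hQ[_ /(_ v)[s sE]]; exists s => y.
exact: (congr1 (fun F : {linear _ -> _} => F y) sE).
Qed.

(** When all extensions of J(v) by M(v) split, an extension of J by M splits
    vertexwise, hence is given by its components g_a : J(s(a)) -> M(t(a)),
    and it splits if and only if g is the coboundary of some c. *)
Definition ext_vanishes (J M : rep Q R) : Prop :=
  forall g : forall a : arrow Q, {linear J (src a) -> M (tgt a)},
  exists c : forall v, {linear J v -> M v},
    forall a x, rep_map M a (c (src a) x) - c (tgt a) (rep_map J a x) = g a x.

(** The extension of J by E with components g contains E as a direct summand. *)
Lemma injective_ext_vanishes (J E : rep Q R) : injective_rep E -> ext_vanishes J E.
Proof.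
move=> injE g.
have /dchoice[m mE] : forall a : arrow Q,
    exists m : {linear (E (src a) * J (src a))%type -> (E (tgt a) * J (tgt a))%type},
    forall z, m z = (rep_map E a z.1 + g a z.2, rep_map J a z.2).
  move=> a; apply: linear_fun => r x y; congr (_, _); rewrite /= !linearP //.
  by rewrite scalerDr addrACA.
pose T := @Rep Q R (fun v => (E v * J v)%type) m.
have /dchoice[i iE] : forall v, exists i : {linear E v -> T v}, forall x, i x = (x, 0).
  by move=> v; have [k kE] := pair_lift (lin_id (E v)) (lin_zero (E v) (J v)); exists k.
have iN a x : i (tgt a) (rep_map E a x) = rep_map T a (i (src a) x).
  by rewrite /= mE !iE /= !linear0 addr0.
have [|r rE] := @injective_rep_extend Q R E E T (RepHom iN) (rep_id E) injE.
  by move=> v x y; rewrite /= !iE => -[].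
have /dchoice[j jE] : forall v, exists j : {linear J v -> T v}, forall x, j x = (0, x).
  by move=> v; have [k kE] := pair_lift (lin_zero (J v) (E v)) (lin_id (J v)); exists k.
exists (fun v => lin_comp (r v) (j v)) => a x /=.
rewrite -[rep_map E a _](rep_hom_natural r) -linearB !jE /= mE /= linear0 add0r.
have -> : (g a x, rep_map J a x) - (0, rep_map J a x) = i (tgt a) (g a x).
  by rewrite iE; congr (_, _); rewrite /= ?subr0 ?subrr.
by rewrite (rE (tgt a)).
Qed.

(** The family g lifts to L, without any compatibility to preserve: this is the
    vanishing of the second extensions of J by the kernel of p. *)
Lemma ext_vanishes_quotient J L M (p : rep_hom L M) :
  locally_injective J -> (forall v, lifts_injectives (p v)) ->
  ext_vanishes J L -> ext_vanishes J M.
Proof.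
move=> injJ lp vJL g.
have /dchoice[k kE] : forall a : arrow Q, exists k : {linear J (src a) -> L (tgt a)},
    forall x, p (tgt a) (k x) = g a x.
  by move=> a; apply: lp.
have [c cE] := vJL k; exists (fun v => lin_comp (p v) (c v)) => a x /=.
by rewrite -rep_hom_natural -linearB cE kE.
Qed.

(** Vertexwise lifts b of h are corrected by a solution c for the family that
    measures their failure to be natural. *)
Lemma ext_vanishes_lift J A B D (i : rep_hom A B) (p : rep_hom B D)
    (h : rep_hom J D) :
  rep_ses i p -> (forall v, lifts_injectives (p v)) -> locally_injective J ->
  ext_vanishes J A ->
  exists u : rep_hom J B, forall v x, p v (u v x) = h v x.
Proof.
move=> ip lp injJ vJA.
have /dchoice[b bE] : forall v, exists b : {linear J v -> B v}, forall x, p v (b x) = h v x.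
  by move=> v; apply: lp.
have /dchoice[g gE] : forall a : arrow Q, exists g : {linear J (src a) -> A (tgt a)},
    forall x, i (tgt a) (g x) = rep_map B a (b (src a) x) - b (tgt a) (rep_map J a x).
  move=> a.
  have [o oE] : exists o : {linear J (src a) -> B (tgt a)},
      forall x, o x = rep_map B a (b (src a) x) - b (tgt a) (rep_map J a x).
    apply: linear_fun => r x y; by rewrite !linearP scalerDr addrACA.
  have [|g gE] := factor_injective (g := o) (ses_inj (ip (tgt a))).
    move=> x; apply/(ses_exact (ip (tgt a))); rewrite oE linearB.
    by rewrite [p _ _ in X in X - _]rep_hom_natural !bE rep_hom_natural subrr.
  by exists g => x; rewrite gE oE.
have [c cE] := vJA g.
have /dchoice[u uE] : forall v, exists u : {linear J v -> B v},
    forall x, u x = b v x - i v (c v x).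
  move=> v; apply: linear_fun => r x y; by rewrite !linearP scalerDr addrACA.
have uN a x : u (tgt a) (rep_map J a x) = rep_map B a (u (src a) x).
  have e : rep_map B a (b (src a) x) - b (tgt a) (rep_map J a x) =
      i (tgt a) (rep_map A a (c (src a) x)) - i (tgt a) (c (tgt a) (rep_map J a x)).
    by rewrite -gE -cE linearB.
  rewrite !uE linearB -rep_hom_natural.
  rewrite -[rep_map B a _](subrK (b (tgt a) (rep_map J a x))) e.
  by rewrite [RHS]addrAC [X in _ = X + _]addrAC subrr add0r addrC.
exists (RepHom uN) => v x; rewrite /= uE linearB /= bE.
by rewrite (ses0 (ip v)) subr0.
Qed.

End Reps.

(** * Representations that are locally Gorenstein injective with lifting *)

Section WalkMaps.
Variables (Q : quiver) (R : pzRingType).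
Implicit Types X Z M : rep Q R.
Implicit Type Y : vertex Q -> lmodType R.

Lemma walk_ext_incl X Y (q : forall v, {linear Y v -> X v}) :
  exists i : rep_hom X (walk_ext q), forall v x, i v x = (x, 0).
Proof.
have /dchoice[i iE] : forall v, exists i : {linear X v -> walk_ext q v},
    forall x, i x = (x, 0).
  move=> v; have [i iE] := pair_lift (lin_id (X v)) (lin_zero (X v) (walk_prod Y v)).
  by exists i.
have iN a x : i (tgt a) (rep_map X a x) = rep_map (walk_ext q) a (i (src a) x).
  rewrite !iE; congr (_, _) => /=.
  have -> : (0 : walk_prod Y (src a)) (Walk1 a) = 0 by [].
  by rewrite linear0 addr0.
by exists (RepHom iN).
Qed.

Lemma walk_ext_map X X' Y (q : forall v, {linear Y v -> X v})
    (q' : forall v, {linear Y v -> X' v}) (f : rep_hom X X') :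
  (forall v y, f v (q v y) = q' v y) ->
  exists F : rep_hom (walk_ext q) (walk_ext q'),
    forall v z, F v z = (f v z.1, z.2).
Proof.
move=> fq.
have /dchoice[F FE] : forall v, exists F : {linear walk_ext q v -> walk_ext q' v},
    forall z, F z = (f v z.1, z.2).
  by move=> v; have [F FE] := pair_map (f v) (lin_id (walk_prod Y v)); exists F.
have FN a z : F (tgt a) (rep_map (walk_ext q) a z)
    = rep_map (walk_ext q') a (F (src a) z).
  rewrite !FE; congr (_, _) => /=.
  by rewrite linearD rep_hom_natural fq.
by exists (RepHom FN).
Qed.

Lemma walk_ext_desc X Y (q : forall v, {linear Y v -> X v}) M (f : rep_hom X M) :
  (forall v y, f v (q v y) = 0) ->
  exists F : rep_hom (walk_ext q) M, forall v z, F v z = f v z.1.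
Proof.
move=> fq; have FN a (z : walk_ext q (src a)) :
    lin_comp (f (tgt a)) (lin_fst _ _) (rep_map (walk_ext q) a z)
    = rep_map M a (lin_comp (f (src a)) (lin_fst _ _) z).
  by rewrite /= linearD rep_hom_natural fq addr0.
by exists (@RepHom Q R (walk_ext q) M (fun v => lin_comp (f v) (lin_fst _ _)) FN).
Qed.

End WalkMaps.

Section Backward.
Variables (Q : quiver) (R : pzRingType).
Hypothesis hQ : source_injective_representation_quiver Q.
Implicit Types M : rep Q R.

Definition locally_GI_lifting M : Prop :=
  (forall v, GI_module (M v)) /\ (forall v, lifts_injectives (out_map M v)).

Lemma walk_ext_locally_GI_lifting M (Y : vertex Q -> lmodType R)
    (q : forall v, {linear Y v -> M v}) :
  (forall v, GI_module (M v)) -> (forall v, injective_module (Y v)) ->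
  (forall v, lifts_injectives (q v)) -> locally_GI_lifting (walk_ext q).
Proof.
move=> GM injY lq; split; last exact: walk_ext_lifts_onto.
by move=> v; apply: GI_pair => //; apply: prodM_injective.
Qed.

Lemma walk_ext_injective_rep M (Y : vertex Q -> lmodType R)
    (q : forall v, {linear Y v -> M v}) :
  locally_injective M -> (forall v, injective_module (Y v)) ->
  (forall v, lifts_injectives (out_map (walk_ext q) v)) ->
  injective_rep (walk_ext q).
Proof.
move=> injM injY lW; apply: injective_repI => //.
exact: walk_ext_locally_injective.
Qed.

(** With k_v : M(v) -> E_v the embeddings into injective modules provided by
    Gorenstein injectivity and N_v their cokernels, the maps M(a) extend to the E_v and
    induce maps between the N_v.  Extending both representations by walks with
    coordinates in the E_v makes the first one injective and leaves the kernel
    M unchanged. *)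
Lemma locally_GI_lifting_right M : locally_GI_lifting M ->
  exists E N (i : rep_hom M E) (p : rep_hom E N),
    [/\ injective_rep E, locally_GI_lifting N, rep_ses i p
      & forall v, lifts_injectives (p v)].
Proof.
move=> [GM _].
have /dchoice[E /dchoice[N /dchoice[k /dchoice[s EP]]]] :=
  fun v => GI_module_right (GM v).
have injE v : injective_module (E v) by case: (EP v).
have GN v : GI_module (N v) by case: (EP v).
have ks v : module_ses (k v) (s v) by case: (EP v).
have ls v : lifts_injectives (s v) by case: (EP v).
have /dchoice[e eE] : forall a : arrow Q, exists e : {linear E (src a) -> E (tgt a)},
    forall x, e (k (src a) x) = k (tgt a) (rep_map M a x).
  move=> a; have [e eE] := injective_module_extend
    (lin_comp (k (tgt a)) (rep_map M a)) (injE (tgt a)) (ses_inj (ks (src a))).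
  by exists e.
have /dchoice[n nE] : forall a : arrow Q, exists n : {linear N (src a) -> N (tgt a)},
    forall x, n (s (src a) x) = s (tgt a) (e a x).
  move=> a; apply: (factor_surjective (g := lin_comp (s (tgt a)) (e a))).
    exact: ses_surj (ks (src a)).
  move=> x /(ses_exact (ks (src a)))[w <-] /=.
  by rewrite eE (ses0 (ks (tgt a))).
pose X := Rep e; pose C := Rep n.
pose kk : rep_hom M X := @RepHom Q R M X k (fun a x => esym (eE a x)).
pose ss : rep_hom X C := @RepHom Q R X C s (fun a x => esym (nE a x)).
pose q v := lin_id (X v).
have [i iE] := walk_ext_incl q.
have [p pE] := @walk_ext_map Q R X C X q s ss (fun v y => erefl).
exists (walk_ext q), (walk_ext (s : forall v, {linear X v -> C v})), (rep_comp i kk), p.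
split.
- apply: walk_ext_injective_rep => //.
  by apply: walk_ext_lifts_onto => v J _ h; exists h.
- exact: walk_ext_locally_GI_lifting.
- move=> v; split=> [x y|[x y]|[x y]].
  + by rewrite /= !iE => -[/(ses_inj (ks v))].
  + rewrite pE /=; split=> [[/(ses_exact (ks v))[w <-] ->]|[w]]; first by exists w; rewrite iE.
    by rewrite iE => -[<- <-]; rewrite (ses0 (ks v)).
  + by have [w <-] := ses_surj (ks v) x; exists (w, y); rewrite pE.
move=> v J injJ h.
have [u uE] := ls v J injJ (lin_comp (lin_fst _ _) h).
have [w wE] := pair_lift u (lin_comp (lin_snd _ _) h).
by exists w => x; rewrite pE wE /= uE /=; case: (h x).
Qed.

(** The covers E_v -> M(v) with kernels N_v carry representations over and under
    M.  The walk coordinates lie in covers Z_v of N_v: a family of maps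
    J -> E_(t(a)) is first matched modulo N by lifting along M(v) and E_v, and
    the error, which lies in N, is produced by the single arrows. *)
Lemma locally_GI_lifting_left M : locally_GI_lifting M ->
  exists N E (i : rep_hom N E) (p : rep_hom E M),
    [/\ injective_rep E, locally_GI_lifting N, rep_ses i p
      & forall v, lifts_injectives (p v)].
Proof.
move=> [GM lM].
have /dchoice[N /dchoice[E /dchoice[k /dchoice[s EP]]]] :=
  fun v => GI_module_left (GM v).
have injE v : injective_module (E v) by case: (EP v).
have GN v : GI_module (N v) by case: (EP v).
have ks v : module_ses (k v) (s v) by case: (EP v).
have ls v : lifts_injectives (s v) by case: (EP v).
have /dchoice[e eE] : forall a : arrow Q, exists e : {linear E (src a) -> E (tgt a)},
    forall x, s (tgt a) (e x) = rep_map M a (s (src a) x).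
  by move=> a; apply: (ls (tgt a) _ (injE (src a)) (lin_comp (rep_map M a) (s (src a)))).
have /dchoice[n nE] : forall a : arrow Q, exists n : {linear N (src a) -> N (tgt a)},
    forall x, k (tgt a) (n x) = e a (k (src a) x).
  move=> a; apply: (factor_injective (g := lin_comp (e a) (k (src a)))).
    exact: ses_inj (ks (tgt a)).
  move=> x; apply/(ses_exact (ks (tgt a))).
  by rewrite /= eE (ses0 (ks (src a))) linear0.
have /dchoice[N' /dchoice[Z /dchoice[k' /dchoice[r ZP]]]] :=
  fun v => GI_module_left (GN v).
have injZ v : injective_module (Z v) by case: (ZP v).
have lr v : lifts_injectives (r v) by case: (ZP v).
pose X := Rep e; pose K := Rep n.
pose kk : rep_hom K X := @RepHom Q R K X k nE.
pose ss : rep_hom X M := @RepHom Q R X M s eE.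
pose q v : {linear Z v -> X v} := lin_comp (k v) (r v).
have [i iE] := @walk_ext_map Q R K X Z r q kk (fun v y => erefl).
have [|p pE] := @walk_ext_desc Q R X Z q M ss.
  by move=> v y; apply: (ses0 (ks v)).
exists (walk_ext (r : forall v, {linear Z v -> K v})), (walk_ext q), i, p; split.
- apply: walk_ext_injective_rep => //; apply: walk_ext_lifts => v J injJ g.
  have [h hE] := prodM_lift (fun a : out_arrow v => lin_comp (ss (tgt (sval a))) (g a)).
  have [x0 x0E] := lM v J injJ h.
  have [x xE] := ls v J injJ x0.
  have /dchoice[y yE] : forall a : out_arrow v, exists y : {linear J -> Z (tgt (sval a))},
      forall t, q _ (y t) = g a t - rep_out_map X a (x t).
    move=> a; have [d dE] : exists d : {linear J -> X (tgt (sval a))},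
        forall t, d t = g a t - rep_out_map X a (x t).
      by apply: linear_fun => b t t'; rewrite !linearP scalerDr addrACA.
    have [|m mE] := factor_injective (g := d) (ses_inj (ks (tgt (sval a)))).
      move=> t; apply/(ses_exact (ks (tgt (sval a)))).
      rewrite dE linearB [X in _ - X](rep_out_natural ss) /= xE.
      have := congr1 (fun f : out_prod M v => f a) (x0E t).
      by rewrite hE /= => <-; rewrite subrr.
    have [y yE] := lr _ _ injJ m; exists y => t.
    by rewrite /q /= yE mE dE.
  by exists x, y => a t; rewrite yE addrC subrK.
- exact: walk_ext_locally_GI_lifting.
- move=> v; split=> [[x y] [x' y']|[x y]|y].
  + by rewrite !iE /= => -[/(ses_inj (ks v)) -> ->].
  + rewrite pE /=; split=> [/(ses_exact (ks v))[w <-]|[[w z]]]; first by exists (w, y); rewrite iE.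
    by rewrite iE => -[<- _]; rewrite (ses0 (ks v)).
  + by have [w <-] := ses_surj (ks v) y; exists (w, 0); rewrite pE.
move=> v J injJ h.
have [u uE] := ls v J injJ h.
have [w wE] := pair_lift u (lin_zero J (walk_prod Z v)).
by exists w => x; rewrite pE wE /= uE.
Qed.

Lemma locally_GI_lifting_ext_vanishes (J : rep Q R) M :
  locally_injective J -> locally_GI_lifting M -> ext_vanishes J M.
Proof.
move=> injJ /locally_GI_lifting_left[N [E [i [p [injE _ _ lp]]]]].
exact/(ext_vanishes_quotient injJ lp)/injective_ext_vanishes.
Qed.

Lemma locally_GI_lifting_gorenstein_injective M :
  locally_GI_lifting M -> @gorenstein_injective (RepCat Q R) M.
Proof.
have lift A B D (i : rep_hom A B) (p : rep_hom B D) : rep_ses i p ->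
    (forall v, lifts_injectives (p v)) -> locally_GI_lifting A -> rep_lifts p.
  move=> ip lp GA J /(injective_rep_local hQ) injJ h.
  exact: (ext_vanishes_lift h ip lp injJ (locally_GI_lifting_ext_vanishes injJ GA)).
apply: (@gorenstein_injective_coind (RepCat Q R) locally_GI_lifting) => N GN.
  have [E [C [i [p [injE GC ip lp]]]]] := locally_GI_lifting_right GN.
  exists E, C, i, p; split=> //; apply/proper_rep_sesP; split=> //.
  exact: lift ip lp GN.
have [K [E [i [p [injE GK ip lp]]]]] := locally_GI_lifting_left GN.
exists K, E, i, p; split=> //; apply/proper_rep_sesP; split=> //.
exact: lift ip lp GK.
Qed.

End Backward.

(** * Evaluation and kernels of Gorenstein injective representations *)

Section Forward.
Variables (Q : quiver) (R : pzRingType).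
Hypothesis hQ : source_injective_representation_quiver Q.
Hypothesis noeth : noetherian_module (R^o : lmodType R).
Implicit Types X M N : rep Q R.

Definition GI_rep M : Prop := @gorenstein_injective (RepCat Q R) M.

Lemma GI_rep_right M : GI_rep M ->
  exists E N (i : rep_hom M E) (p : rep_hom E N),
    [/\ injective_rep E, GI_rep N, rep_ses i p & rep_lifts p].
Proof.
move=> /gorenstein_injective_steps[[E [N [i [p [injE GN /proper_rep_sesP[ip lp]]]]]] _].
by exists E, N, i, p.
Qed.

Lemma GI_rep_left M : GI_rep M ->
  exists N E (i : rep_hom N E) (p : rep_hom E M),
    [/\ injective_rep E, GI_rep N, rep_ses i p & rep_lifts p].
Proof.
move=> /gorenstein_injective_steps[_ [N [E [i [p [injE GN /proper_rep_sesP[ip lp]]]]]]].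
by exists N, E, i, p.
Qed.

(** The family g is a coboundary of some b after M is embedded in an injective E.
    Modulo M, b becomes natural, so it lifts to a morphism c : Z -> E, and b - c
    takes values in M and has the same coboundary as b. *)
Lemma GI_rep_ext_vanishes (Z : rep Q R) M :
  injective_rep Z -> GI_rep M -> ext_vanishes Z M.
Proof.
move=> injZ /GI_rep_right[E [N [i [p [injE _ ip lp]]]]] g.
have [b bE] := injective_ext_vanishes injE (fun a => lin_comp (i (tgt a)) (g a)).
have pbN a x : lin_comp (p (tgt a)) (b (tgt a)) (rep_map Z a x)
    = rep_map N a (lin_comp (p (src a)) (b (src a)) x).
  apply/eqP; rewrite eq_sym -subr_eq0 /= -rep_hom_natural -linearB bE /=.
  by rewrite (ses0 (ip (tgt a))).
have [c cE] := lp Z injZ (@RepHom Q R Z N (fun v => lin_comp (p v) (b v)) pbN).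
have /dchoice[d dE] : forall v, exists d : {linear Z v -> M v},
    forall x, i v (d x) = b v x - c v x.
  move=> v; have [k kE] : exists k : {linear Z v -> E v}, forall x, k x = b v x - c v x.
    by apply: linear_fun => r x y; rewrite !linearP scalerDr addrACA.
  have [|d dE] := factor_injective (g := k) (ses_inj (ip v)).
    by move=> x; apply/(ses_exact (ip v)); rewrite kE linearB cE subrr.
  by exists d => x; rewrite dE kE.
exists d => a x; apply: (ses_inj (ip (tgt a))).
rewrite linearB rep_hom_natural !dE linearB -rep_hom_natural.
by rewrite opprB subrKA -[RHS]bE.
Qed.

Definition zero_rep : rep Q R :=
  @Rep Q R (fun _ => prodM (fun i : False => match i return lmodType R with end))
    (fun _ => lin_zero _ _).

Lemma zero_rep_eq v (x y : zero_rep v) : x = y.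
Proof. by apply: functional_extensionality_dep => -[]. Qed.

(** X(v) is the direct sum of copies of I indexed by the maps g : I -> N(v), and
    an arrow a sends the copy of g to the copy of N(a) g. *)
Lemma coproduct_rep (I : lmodType R) N : injective_module I ->
  exists (X : rep Q R) (t : rep_hom X N), locally_injective X /\
    forall v (g : {linear I -> N v}), exists j : {linear I -> X v},
      forall x, t v (j x) = g x.
Proof.
move=> injI.
have /dchoice[S /dchoice[inc SP]] :=
  fun v => injective_coproduct {linear I -> N v} noeth injI.
have /dchoice[m mE] : forall a : arrow Q, exists m : {linear S (src a) -> S (tgt a)},
    forall g x, m (inc (src a) g x) = inc (tgt a) (lin_comp (rep_map N a) g) x.
  by move=> a; have [_ desc _] := SP (src a); apply: desc.
have /dchoice[t tE] : forall v, exists t : {linear S v -> N v},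
    forall g x, t (inc v g x) = g x.
  by move=> v; have [_ desc _] := SP v; apply: desc.
pose X := Rep m.
have tN a x : t (tgt a) (rep_map X a x) = rep_map N a (t (src a) x).
  have [_ _ ext] := SP (src a).
  apply: (ext _ (lin_comp (t (tgt a)) (m a)) (lin_comp (rep_map N a) (t (src a)))).
  by move=> g y; rewrite /= mE !tE.
exists X, (@RepHom Q R X N t tN); split=> [v|v g]; first by case: (SP v).
by exists (inc v g) => x; apply: tE.
Qed.

(** The extension of X by walks with coordinates in X is an injective
    representation containing X; the quotient is the extension Z of the zero
    representation, again injective.  The obstruction to extending t lies in the
    extensions of Z by N, which vanish. *)
Lemma walk_ext_hom X N (t : rep_hom X N) : locally_injective X -> GI_rep N ->
  exists h : rep_hom (walk_ext (fun v => lin_id (X v))) N,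
    forall v x, h v (x, 0) = t v x.
Proof.
move=> injX GN.
pose q v := lin_zero (X v) (zero_rep v); pose Z := walk_ext q.
have injZ : injective_rep Z.
  apply: walk_ext_injective_rep => //.
    by move=> v; apply: prodM_injective => -[].
  apply: walk_ext_lifts_onto => v J _ h; exists (lin_zero J (X v)) => x.
  exact: zero_rep_eq.
have /dchoice[g gE] : forall a : arrow Q, exists g : {linear Z (src a) -> N (tgt a)},
    forall z, g z = t (tgt a) (z.2 (Walk1 a)).
  move=> a; have [p pE] := prodM_proj (fun w : walk (src a) => X (walk_end w)) (Walk1 a).
  by exists (lin_comp (lin_comp (t (tgt a)) p) (lin_snd _ _)) => z; rewrite /= pE.
have [c cE] := GI_rep_ext_vanishes injZ GN g.
have /dchoice[h hE] : forall v,
    exists h : {linear walk_ext (fun v => lin_id (X v)) v -> N v},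
    forall z, h z = t v z.1 + c v (0, z.2).
  move=> v; have [k kE] := pair_lift (lin_zero (walk_prod X v) (zero_rep v)) (lin_id _).
  apply: linear_fun => r x y; rewrite /= linearP.
  have -> : (0, r *: x.2 + y.2) = r *: (0, x.2) + (0, y.2) :> Z v.
    by congr (_, _); rewrite /= scaler0 addr0.
  by rewrite linearP scalerDr addrACA.
have hN a z : h (tgt a) (rep_map (walk_ext (fun v => lin_id (X v))) a z)
    = rep_map N a (h (src a) z).
  rewrite !hE linearD /= linearD rep_hom_natural -addrA; congr (_ + _).
  have := cE a (0, z.2); rewrite gE /= => <-.
  have -> : rep_map Z a (0, z.2) = (0, fun w => z.2 (WalkS w)).
    by congr (_, _); apply: zero_rep_eq.
  by rewrite subrK.
exists (RepHom hN) => v x; rewrite /= hE /=.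
have -> : ((0, 0) : Z v) = 0 by [].
by rewrite linear0 addr0.
Qed.

(** Every g : I -> N(v) factors through a morphism h to N from an injective
    representation, and h lifts along p. *)
Lemma GI_rep_lifts_at (E : rep Q R) N (p : rep_hom E N) : GI_rep N -> rep_lifts p ->
  forall v, lifts_injectives (p v).
Proof.
move=> GN lp v I injI g.
have [X [t [injX tE]]] := coproduct_rep N injI.
have [h hE] := walk_ext_hom t injX GN.
have [|u uE] := lp _ _ h.
  apply: walk_ext_injective_rep => //.
  by apply: walk_ext_lifts_onto => w J _ k; exists k.
have [j jE] := tE v g.
have [i iE] := walk_ext_incl (fun v => lin_id (X v)).
by exists (lin_comp (lin_comp (u v) (i v)) j) => x; rewrite /= uE iE hE jE.
Qed.

(** Maps to the product lift along a proper cover E -> M, and the corresponding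
    map for E is a split epimorphism. *)
Lemma GI_rep_out_lifts M : GI_rep M -> forall v, lifts_injectives (out_map M v).
Proof.
move=> GM v J injJ h.
have [N [E [i [p [injE _ _ lp]]]]] := GI_rep_left GM.
have /dchoice[e eE] : forall a : out_arrow v, exists e : {linear J -> E (tgt (sval a))},
    forall x, p _ (e x) = h x a.
  move=> a; have [pr prE] : exists pr : {linear out_prod M v -> M (tgt (sval a))},
      forall x, pr x = x a by apply: prodM_proj.
  have [e eE] := GI_rep_lifts_at GM lp injJ (lin_comp pr h).
  by exists e => x; rewrite eE /= prE.
have [u uE] := prodM_lift e.
have [s sE] := injective_rep_split v hQ injE.
exists (lin_comp (p v) (lin_comp s u)) => x.
apply: functional_extensionality_dep => a.
rewrite -[LHS]/(rep_out_map M a (p v (s (u x)))) -rep_out_natural.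
by rewrite -[rep_out_map E a _]/(out_map E v (s (u x)) a) sE uE eE.
Qed.

Lemma GI_rep_out_surjective M v : GI_rep M ->
  forall y, exists x, out_map M v x = y.
Proof.
move=> GM y.
have [N [E [i [p [injE _ ip _]]]]] := GI_rep_left GM.
have /dchoice[e eE] : forall a : out_arrow v, exists e : E (tgt (sval a)), p _ e = y a.
  by move=> a; apply: (ses_surj (ip _)).
have [s sE] := injective_rep_split v hQ injE.
exists (p v (s (e : out_prod E v))); apply: functional_extensionality_dep => a.
rewrite -[LHS]/(rep_out_map M a (p v (s _))) -rep_out_natural.
by rewrite -[rep_out_map E a _]/(out_map E v (s (e : out_prod E v)) a) sE eE.
Qed.

Lemma GI_rep_at M v : GI_rep M -> GI_module (M v).
Proof.
move=> GM; apply: (@GI_module_coind R (fun V => exists2 N, GI_rep N & V = N v)).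
- move=> _ [N GN ->]; have [E [C [i [p [injE GC ip lp]]]]] := GI_rep_right GN.
  exists (E v), (C v), (i v), (p v); split=> //; last exact: GI_rep_lifts_at.
    exact: injective_rep_local.
  by exists C.
- move=> _ [N GN ->]; have [K [E [i [p [injE GK ip lp]]]]] := GI_rep_left GN.
  exists (K v), (E v), (i v), (p v); split=> //; last exact: GI_rep_lifts_at.
    exact: injective_rep_local.
  by exists K.
by exists M.
Qed.

Lemma out_map_natural M N (f : rep_hom M N) v x (a : out_arrow v) :
  out_map N v (f v x) a = f (tgt (sval a)) (out_map M v x a).
Proof. exact/esym/rep_out_natural. Qed.

(** The snake lemma for the maps f_v of A, B and D, for elements and then for maps
    from injective modules: an element of ker f_v for D lifts to B(v), its image
    under f_v comes from the product for A, and can be removed by an element of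
    A(v). *)
Lemma ker_out_map_ses (A B D : rep Q R) (i : rep_hom A B) (p : rep_hom B D) v :
  rep_ses i p -> lifts_injectives (p v) ->
  (forall y, exists x, out_map A v x = y) -> lifts_injectives (out_map A v) ->
  exists (i' : {linear ker (out_map A v) -> ker (out_map B v)})
    (p' : {linear ker (out_map B v) -> ker (out_map D v)}),
    module_ses i' p' /\ lifts_injectives p'.
Proof.
move=> ip lp surjA lA.
have kerF X (Y : rep Q R) (f : rep_hom X Y) :
    exists F : {linear ker (out_map X v) -> ker (out_map Y v)},
    forall k, ker_incl (out_map Y v) (F k) = f v (ker_incl (out_map X v) k).
  apply: (factor_injective (g := lin_comp (f v) (ker_incl (out_map X v)))).
    exact: ker_incl_inj.
  move=> k; apply: ker_lift; apply: functional_extensionality_dep => a.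
  by rewrite out_map_natural ker_inclP linear0.
have [i' i'E] := kerF _ _ i; have [p' p'E] := kerF _ _ p.
have [injB injD] := (@ker_incl_inj _ _ _ (out_map B v), @ker_incl_inj _ _ _ (out_map D v)).
have outB b : out_map D v (p v b) = 0 -> exists y : out_prod A v,
    forall a, i (tgt (sval a)) (y a) = out_map B v b a.
  move=> pb0; have /dchoice[y yE] : forall a : out_arrow v, exists y : A (tgt (sval a)),
      i (tgt (sval a)) y = out_map B v b a.
    by move=> a; apply/(ses_exact (ip _)); rewrite -out_map_natural pb0.
  by exists y.
exists i', p'; split.
  split=> [x y xy|k|k].
  - apply: (@ker_incl_inj _ _ _ (out_map A v)); apply: (ses_inj (ip v)).
    by rewrite -!i'E xy.
  - split=> [pk0|[w <-]]; last first.
      by apply: injD; rewrite p'E i'E (ses0 (ip v)) linear0.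
    have /(ses_exact (ip v))[w wE] : p v (ker_incl _ k) = 0 by rewrite -p'E pk0 linear0.
    have [w' w'E] : exists w', ker_incl (out_map A v) w' = w.
      apply: ker_lift; apply: functional_extensionality_dep => a.
      apply: (ses_inj (ip (tgt (sval a)))).
      by rewrite -out_map_natural wE ker_inclP linear0.
    by exists w'; apply: injB; rewrite i'E w'E.
  have [b bE] := ses_surj (ip v) (ker_incl _ k).
  have [|y yE] := outB b; first by rewrite bE ker_inclP.
  have [x xy] := surjA y.
  have [b' b'E] : exists b', ker_incl (out_map B v) b' = b - i v x.
    apply: ker_lift; rewrite linearB; apply/eqP; rewrite subr_eq0; apply/eqP.
    by apply: functional_extensionality_dep => a; rewrite out_map_natural xy yE.
  by exists b'; apply: injD; rewrite p'E b'E linearB bE (ses0 (ip v)) subr0.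
move=> J injJ h.
have [u uE] := lp J injJ (lin_comp (ker_incl (out_map D v)) h).
have [y yE] : exists y : {linear J -> out_prod A v}, forall t a,
    i (tgt (sval a)) (y t a) = out_map B v (u t) a.
  apply: (@linear_graph R J (out_prod A v) (fun t y => forall a : out_arrow v,
      i (tgt (sval a)) (y a) = out_map B v (u t) a)).
  - move=> r t t' z z' zE z'E a; rewrite !linearP.
    rewrite -[RHS]/(r *: out_map B v (u t) a + out_map B v (u t') a) -zE -z'E.
    by rewrite -linearP.
  - by move=> t; apply: outB; rewrite uE; apply: ker_inclP.
  move=> z zE; apply: functional_extensionality_dep => a.
  by apply: (ses_inj (ip _)); rewrite zE !linear0.
have [x xE] := lA J injJ y.
have [d dE] : exists d : {linear J -> B v}, forall t, d t = u t - i v (x t).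
  by apply: linear_fun => r t t'; rewrite !linearP scalerDr addrACA.
have [|w wE] := factor_injective (g := d) injB.
  move=> t; apply: ker_lift; rewrite dE linearB; apply/eqP; rewrite subr_eq0; apply/eqP.
  by apply: functional_extensionality_dep => a; rewrite out_map_natural xE yE.
exists w => t; apply: injD.
by rewrite p'E wE dE linearB (ses0 (ip v)) subr0 uE.
Qed.

Lemma ker_out_map_injective (E : rep Q R) v :
  injective_rep E -> injective_module (ker (out_map E v)).
Proof.
move=> injE; have [s sE] := injective_rep_split v hQ injE.
have [d dE] : exists d : {linear E v -> E v}, forall x, d x = x - s (out_map E v x).
  by apply: linear_fun => r x y; rewrite !linearP scalerDr addrACA.
have [||r rE] := factor_injective (g := d) (j := ker_incl (out_map E v)).
- exact: ker_incl_inj.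
- by move=> x; apply: ker_lift; rewrite dE linearB sE subrr.
apply: (@retract_injective R (E v) _ (ker_incl (out_map E v)) r).
  move=> k; apply: (@ker_incl_inj _ _ _ (out_map E v)).
  by rewrite rE dE ker_inclP linear0 subr0.
exact: injective_rep_local.
Qed.

Lemma GI_rep_ker M v : GI_rep M -> GI_module (ker (out_map M v)).
Proof.
move=> GM; apply: (@GI_module_coind R (fun V =>
  exists2 N, GI_rep N & V = ker (out_map N v) :> lmodType R)).
- move=> _ [N GN ->]; have [E [C [i [p [injE GC ip lp]]]]] := GI_rep_right GN.
  have [|||i' [p' [ip' lp']]] := @ker_out_map_ses _ _ _ i p v ip.
  + exact: GI_rep_lifts_at.
  + exact: GI_rep_out_surjective.
  + exact: GI_rep_out_lifts.
  exists (ker (out_map E v)), (ker (out_map C v)), i', p'; split=> //.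
    exact: ker_out_map_injective.
  by exists C.
- move=> _ [N GN ->]; have [K [E [i [p [injE GK ip lp]]]]] := GI_rep_left GN.
  have [|||i' [p' [ip' lp']]] := @ker_out_map_ses _ _ _ i p v ip.
  + exact: GI_rep_lifts_at.
  + exact: GI_rep_out_surjective.
  + exact: GI_rep_out_lifts.
  exists (ker (out_map K v)), (ker (out_map E v)), i', p'; split=> //.
    exact: ker_out_map_injective.
  by exists K.
by exists M.
Qed.

End Forward.

Lemma ker_module_ses (R : pzRingType) (U V : lmodType R) (f : {linear U -> V}) :
  (forall y, exists x, f x = y) -> module_ses (ker_incl f) f.
Proof.
split=> //; first exact: ker_incl_inj.
by move=> x; split=> [/ker_lift//|[k <-]]; apply: ker_inclP.
Qed.

Theorem corollary6p3 (Q : quiver) (R : pzRingType)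
    (hQ : source_injective_representation_quiver Q) (hR : gorenstein_ring R)
    (M : rep Q R) :
  @gorenstein_injective (RepCat Q R) M <->
  (forall v : vertex Q,
     @gorenstein_injective (LMod R) (M v) /\
     @short_exact (LMod R) (ker (out_map M v)) (M v) (out_prod M v)
       (ker_incl (out_map M v)) (out_map M v) /\
     @gorenstein_injective (LMod R) (ker (out_map M v))).
Proof.
have [noeth _ _ _] := hR; split=> [GM v|MP].
  have surjM := @GI_rep_out_surjective Q R hQ M v GM.
  have [injk ex _] := ker_module_ses surjM.
  split; first exact: GI_rep_at.
  split; last exact: GI_rep_ker.
  split; [exact/LMod_monoP| |exact/LMod_epiP].
  exists (ker (out_map M v) : lmodType R), (ker_incl (out_map M v)), (lin_id _); split.
  - exact/LMod_kernelP.
  - by apply/LMod_epiP => y; exists y.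
  exact: linear_ext.
apply: locally_GI_lifting_gorenstein_injective => //; split=> v.
  by have [GMv _] := MP v.
have [_ [[_ _ /LMod_epiP surjM] Gker]] := MP v.
exact: GI_kernel_lifts Gker (ker_module_ses surjM).
Qed.
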